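(* For every $z\in H$ there exist $k,m,n\in\mathbb{Z}_{\geq 0}$ such that the centralizer $C_H(z)=\{g\in H\mid gz=zg\}$ satisfies $$C_{H}(z)\cong(\mathbb{Z},+)^{n}\times(\mathbb{R},+)^{m}\times H^{k}$$ as groups.
   Context: Monod's group $H=H(\mathbb{R})$: the group, under composition, of all homeomorphisms $f$ of $\mathbb{R}\mathrm{P}^1=\mathbb{R}\cup\{\infty\}$ with $f(\infty)=\infty$ for which there are finitely many real points $t_0<\dots<t_n$ such that on each of the intervals $(-\infty,t_0]$, $[t_i,t_{i+1}]$, $[t_n,+\infty)$ the map $f$ coincides with a Möbius transformation $t\mapsto\frac{at+b}{ct+d}$ with $a,b,c,d\in\mathbb{R}$, $ad-bc=1$ (the coefficients depend on the interval). (In the definition of Monod's groups the points $t_i$ must be fixed points of hyperbolic elements of $\mathrm{PSL}_2(\mathbb{R})$; over $\mathbb{R}$ this is no restriction.) Elements of $H$ are regarded as increasing homeomorphisms of $\mathbb{R}$; they are affine near $-\infty$ and near $+\infty$. *)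

(* Defs.v *)
From HB Require Import structures.
From mathcomp Require Import all_boot all_order all_algebra.
From mathcomp Require Import all_classical all_reals all_analysis.
From mathcomp Require Import ring lra.
Set Implicit Arguments.
Unset Strict Implicit.
Unset Printing Implicit Defensive.
Import Order.TTheory GRing.Theory Num.Theory.
Import numFieldNormedType.Exports.
Local Open Scope classical_set_scope.
Local Open Scope ring_scope.

Definition group_isomorphic (G K : groupType) : Prop :=
  exists2 phi : G -> K, bijective phi & {morph phi : x y / (x * y)%g}.

Section Centralizer.
Variables (G : groupType) (z : G).

Definition centralizes : {pred G} := [pred g | (g * z == z * g)%g].

Record centralizer := Centralizer {
  centralizer_val :> G;
  _ : centralizer_val \in centralizes }.

HB.instance Definition _ := [isSub for centralizer_val].
HB.instance Definition _ := [Choice of centralizer by <:].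

Lemma centralizes_group_closed : group_closed centralizes.
Proof.
split; first by rewrite inE mul1g mulg1.
move=> x y; rewrite !inE => /eqP xz /eqP yz; apply/eqP.
have yVz : (y^-1 * z = z * y^-1)%g.
  by apply: (mulgI y); rewrite mulgA mulgV mul1g mulgA yz -mulgA mulgV mulg1.
by rewrite -mulgA yVz mulgA xz mulgA.
Qed.

HB.instance Definition _ :=
  SubChoice_isSubGroup.Build G centralizes centralizer centralizes_group_closed.

End Centralizer.

Section Homeo.
Variable T : topologicalType.

Definition is_homeo (f : T -> T) : Prop :=
  continuous f /\ exists g : T -> T, [/\ continuous g, cancel f g & cancel g f].

Record homeo := Homeo {
  homeo_fun :> T -> T;
  _ : `[< is_homeo homeo_fun >] }.

HB.instance Definition _ := [isSub for homeo_fun].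
HB.instance Definition _ := [Choice of homeo by <:].

Lemma homeoP (f : homeo) : is_homeo f.
Proof. by case: f => f /= /asboolP. Qed.

Lemma is_homeo_id : `[< is_homeo id >].
Proof. by apply/asboolP; split; [move=> x|exists id; split=> // x]. Qed.

Lemma is_homeo_comp (f g : homeo) : `[< is_homeo (f \o g) >].
Proof.
have [cf [f' [cf' fK f'K]]] := homeoP f; have [cg [g' [cg' gK g'K]]] := homeoP g.
apply/asboolP; split.
  by move=> x; apply: continuous_comp; [exact: cg|exact: cf].
exists (g' \o f'); split; [|exact: (can_comp fK gK)|exact: (can_comp g'K f'K)].
by move=> x; apply: continuous_comp; [exact: cf'|exact: cg'].
Qed.

Definition homeo_inv_fun (f : homeo) : T -> T := projT1 (cid (homeoP f).2).

Lemma is_homeo_inv (f : homeo) : `[< is_homeo (homeo_inv_fun f) >].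
Proof.
rewrite /homeo_inv_fun; case: cid => g /= [cg fK gK].
apply/asboolP; split=> //; exists f; split=> //.
by have [] := homeoP f.
Qed.

Definition homeo_one : homeo := Homeo is_homeo_id.
Definition homeo_mul (f g : homeo) : homeo := Homeo (is_homeo_comp f g).
Definition homeo_inv (f : homeo) : homeo := Homeo (is_homeo_inv f).

Lemma homeo_mulA : associative homeo_mul.
Proof. by move=> f g h; apply: val_inj. Qed.
Lemma homeo_mul1 : left_id homeo_one homeo_mul.
Proof. by move=> f; apply: val_inj. Qed.
Lemma homeo_mulr1 : right_id homeo_one homeo_mul.
Proof. by move=> f; apply: val_inj. Qed.
Lemma homeo_mulV : left_inverse homeo_one homeo_inv homeo_mul.
Proof.
move=> f; apply: val_inj; apply/funext => x /=.
by rewrite /homeo_inv_fun; case: cid => g /= [].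
Qed.
Lemma homeo_mulrV : right_inverse homeo_one homeo_inv homeo_mul.
Proof.
move=> f; apply: val_inj; apply/funext => x /=.
by rewrite /homeo_inv_fun; case: cid => g /= [].
Qed.

HB.instance Definition _ := isGroup.Build homeo
  homeo_mulA homeo_mul1 homeo_mulr1 homeo_mulV homeo_mulrV.

Lemma homeoM (f g : homeo) x : (f * g)%g x = f (g x). Proof. by []. Qed.
Lemma homeo1 x : (1%g : homeo) x = x. Proof. by []. Qed.
Lemma homeoK (f : homeo) : cancel f (f^-1)%g.
Proof. by move=> x; rewrite -homeoM mulVg. Qed.
Lemma homeoVK (f : homeo) : cancel (f^-1)%g f.
Proof. by move=> x; rewrite -homeoM mulgV. Qed.
Lemma homeo_continuous (f : homeo) : continuous f.
Proof. by have [] := homeoP f. Qed.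

End Homeo.

(* Monod's group H(R), as the subgroup monodH R of homeo (RP1 R). *)
Section Monod.
Variable R : realType.

(* The real projective line (a circle) is the one-point compactification of R;
   the point at infinity is None. *)
Definition RP1 : topologicalType := one_point_compactification R.

Definition infty : RP1 := None.
Definition fin (t : R) : RP1 := Some t.

Definition mobius (a b c d : R) (x : RP1) : RP1 :=
  match x with
  | Some t => if c * t + d == 0 then infty else fin ((a * t + b) / (c * t + d))
  | None => if c == 0 then infty else fin (a / c)
  end.

Definition mobius_on (f : RP1 -> RP1) (I : set R) : Prop :=
  exists a b c d : R, a * d - b * c = 1 /\
    forall t, I t -> f (fin t) = mobius a b c d (fin t).

(* Only the values t 0 < ... < t n matter. Over the reals every t i is fixed by
   some hyperbolic element of PSL_2, so break points carry no condition. *)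
Definition piecewise_mobius (f : RP1 -> RP1) : Prop :=
  exists (n : nat) (t : nat -> R),
    [/\ forall i, (i < n)%N -> t i < t i.+1,
        mobius_on f `]-oo, t 0%N],
        forall i, (i < n)%N -> mobius_on f `[t i, t i.+1]
      & mobius_on f `[t n, +oo[ ].

Definition monodH_pred : {pred homeo RP1} :=
  [pred f : homeo RP1 | `[< f infty = infty /\ piecewise_mobius f >]].

Record monodH := MonodH {
  monodH_val :> homeo RP1;
  _ : monodH_val \in monodH_pred }.

HB.instance Definition _ := [isSub for monodH_val].
HB.instance Definition _ := [Choice of monodH by <:].

Lemma monodHP (f : homeo RP1) :
  f \in monodH_pred <-> f infty = infty /\ piecewise_mobius f.
Proof. by split=> [fH|fH]; apply/asboolP. Qed.

Definition straddled (C : set R) (a : R) := exists x y, [/\ C x, C y, x < a & a < y].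

Lemma not_straddled C a : ~ straddled C a ->
  C `<=` `]-oo, a] \/ C `<=` `[a, +oo[.
Proof.
move=> nS; have [?|/existsNP[y /not_implyP[Cy]]] := pselect (C `<=` `]-oo, a]).
  by left.
rewrite /= in_itv/= => /negP; rewrite -ltNge => ay; right=> x Cx /=.
rewrite in_itv/= andbT leNgt; apply/negP => xa; apply: nS; exists x, y; split=> //.
Qed.

Lemma mobius_onS f (A B : set R) : A `<=` B -> mobius_on f B -> mobius_on f A.
Proof.
move=> AB [a [b [c [d [D H]]]]]; exists a, b, c, d; split=> // t At.
exact/H/AB.
Qed.

Lemma piecewise_mobiusP f : piecewise_mobius f <->
  exists s : seq R, forall C : set R,
    (forall a, a \in s -> ~ straddled C a) -> mobius_on f C.
Proof.
split=> [[n [t [tlt H0 Hi Hn]]]|[s Hs]].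
  exists [seq t i | i <- iota 0 n.+1] => C nC.
  have tC i : (i <= n)%N -> C `<=` `]-oo, t i] \/ C `<=` `[t i, +oo[.
    move=> ile; apply/not_straddled/nC/mapP; exists i => //.
    by rewrite mem_iota /= ltnS.
  have key j : (j <= n)%N -> C `<=` `[t j, +oo[ \/ mobius_on f C.
    elim: j => [_|j IH jn].
      by case: (tC 0%N (leq0n _)) => H; [right; apply: mobius_onS H0|left].
    case: (IH (ltnW jn)) => [Cj|]; last by right.
    case: (tC _ jn) => Cj1; last by left.
    right; apply: mobius_onS (Hi j jn) => x Cx /=.
    move: (Cj x Cx) (Cj1 x Cx); rewrite /= !in_itv/= andbT => -> //.
  by case: (key n (leqnn n)) => // H; apply: mobius_onS Hn.
pose u := sort <=%O (undup (0 :: s)).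
have us : sorted <%O u by rewrite sort_lt_sorted undup_uniq.
have su : (0 < size u)%N.
  rewrite size_sort lt0n size_eq0; apply/eqP => E.
  by have := mem_undup (0 :: s) 0; rewrite E in_nil mem_head.
have uin a : a \in s -> exists2 k, (k < size u)%N & a = nth 0 u k.
  move=> as_; have au : a \in u by rewrite mem_sort mem_undup inE as_ orbT.
  by exists (index a u); rewrite ?index_mem ?nth_index.
have ule i j : (i < size u)%N -> (j < size u)%N -> (i <= j)%N ->
    nth 0 u i <= nth 0 u j.
  by move=> ? ? ij; apply: sorted_leq_nth => //;
    [exact: le_trans|exact: sort_le_sorted].
exists (size u).-1, (nth 0 u); split.
- move=> i iu; have i1u : (i.+1 < size u)%N by case: (size u) su iu.
  by apply: (sorted_ltn_nth lt_trans) => //; rewrite inE// ltnW.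
- apply: Hs => a /uin[k ku ->] [x [y []]] /=; rewrite !in_itv/= => _ y0 _ ky.
  by have := ule _ _ su ku (leq0n _); rewrite leNgt (lt_le_trans ky y0).
- move=> i iu; have i1u : (i.+1 < size u)%N by case: (size u) su iu.
  apply: Hs => a /uin[k ku ->] [x [y []]] /=.
  rewrite !in_itv/= => /andP[ix _] /andP[_ yi] xk ky.
  have [ki|ik] := leqP k i.
    by have := ule _ _ ku (ltnW i1u) ki; rewrite leNgt (le_lt_trans ix xk).
  by have := ule _ _ i1u ku ik; rewrite leNgt (lt_le_trans ky yi).
- have nu : ((size u).-1 < size u)%N by case: (size u) su.
  apply: Hs => a /uin[k ku ->] [x [y []]] /=.
  rewrite !in_itv/= !andbT => nx _ xk _.
  have kn : (k <= (size u).-1)%N by case: (size u) su ku.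
  by have := ule _ _ ku nu kn; rewrite leNgt (le_lt_trans nx xk).
Qed.

Definition real_part (f : RP1 -> RP1) (t : R) : R :=
  if f (fin t) is Some u then u else 0.

Section FixInfty.
Variable f : homeo RP1.
Hypothesis foo : f infty = infty.

Lemma real_partE t : f (fin t) = fin (real_part f t).
Proof.
rewrite /real_part; case E: (f (fin t)) => [u|] //.
suff: (Some t : option R) = None by [].
by apply: (can_inj (homeoK f)); rewrite foo; exact: E.
Qed.

Lemma fixV : (f^-1)%g infty = infty.
Proof. by rewrite -{1}foo homeoK. Qed.

Lemma real_part_inj : injective (real_part f).
Proof.
move=> x y E; suff: fin x = fin y by case.
by apply: (can_inj (homeoK f)); rewrite !real_partE E.
Qed.

Lemma real_part_continuous : continuous (real_part f).
Proof.
move=> x U /= Ux.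
have /= nU : nbhs (f (fin x)) (fin @` U).
  by rewrite real_partE; exact: one_point_compactification_some_nbhs.
have := @homeo_continuous _ f (fin x) _ nU.
rewrite /= /nbhs/= => H.
apply: filterS H => t /= [u Uu]; rewrite real_partE => -[<-] //.
Qed.

Lemma straddled_real_part (C : set R) a :
  straddled (real_part f @` C) (real_part f a) -> straddled C a.
Proof.
have H : {within [set` `]-oo, +oo[%R], continuous (real_part f)}.
  by apply: continuous_subspaceT; exact: real_part_continuous.
have [||fm|fm] := @itv_continuous_inj_mono R (real_part f) `]-oo, +oo[%R.
- exact: H.
- by move=> x y _ _; exact: real_part_inj.
- move=> [_ [_ [[x Cx <-] [y Cy <-]]]].
  by rewrite !(leW_mono_in (le_mono_in fm)) ?in_itv// => ? ?; exists x, y.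
- move=> [_ [_ [[x Cx <-] [y Cy <-]]]].
  by rewrite !(leW_nmono_in (le_nmono_in fm)) ?in_itv// => ? ?; exists y, x.
Qed.

End FixInfty.

Lemma real_partK (f : homeo RP1) : f infty = infty ->
  cancel (real_part f) (real_part (f^-1)%g).
Proof.
move=> foo t; suff: fin (real_part (f^-1)%g (real_part f t)) = fin t by case.
by rewrite -real_partE ?fixV// -real_partE// homeoK.
Qed.

Lemma monodH_mul (f g : homeo RP1) :
  f \in monodH_pred -> g \in monodH_pred -> (f * g)%g \in monodH_pred.
Proof.
move=> /monodHP[foo /piecewise_mobiusP[sf Hf]] /monodHP[goo /piecewise_mobiusP[sg Hg]].
apply/monodHP; split; first by rewrite homeoM goo.
apply/piecewise_mobiusP; exists (sg ++ map (real_part (g^-1)%g) sf) => C nC.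
have [a [b [c [d [D gC]]]]] : mobius_on g C.
  by apply: Hg => x xs; apply: nC; rewrite mem_cat xs.
have [a' [b' [c' [d' [D' fC]]]]] : mobius_on f (real_part g @` C).
  apply: Hf => x xs S; apply: (nC (real_part (g^-1)%g x)).
    by rewrite mem_cat map_f ?orbT.
  apply: (straddled_real_part goo).
  by have := real_partK (fixV goo) x; rewrite invgK => ->.
exists (a' * a + b' * c), (a' * b + b' * d), (c' * a + d' * c), (c' * b + d' * d).
split; first by nra.
move=> t Ct; rewrite homeoM.
have gt := gC t Ct; have := fC (real_part g t) (ex_intro2 _ _ t Ct erefl).
rewrite -real_partE// => ->; rewrite gt.
move: gt; rewrite real_partE// /=; case: eqP => // /eqP nz [_].
have -> : (c' * a + d' * c) * t + (c' * b + d' * d) =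
  (c' * ((a * t + b) / (c * t + d)) + d') * (c * t + d) by field.
rewrite mulf_eq0 (negbTE nz) orbF /=; case: eqP => // /eqP nz'.
congr fin; field; rewrite nz /=.
apply: contraNN nz' => /eqP E; apply/eqP/(mulIf nz); rewrite mul0r -[RHS]E.
by field.
Qed.

Lemma monodH_inv (f : homeo RP1) : f \in monodH_pred -> (f^-1)%g \in monodH_pred.
Proof.
move=> /monodHP[foo /piecewise_mobiusP[sf Hf]].
apply/monodHP; split; first exact: fixV.
apply/piecewise_mobiusP; exists (map (real_part f) sf) => C nC.
have [a [b [c [d [D fC]]]]] : mobius_on f (real_part (f^-1)%g @` C).
  apply: Hf => x xs S; apply: (nC (real_part f x)); first exact: map_f.
  apply: (straddled_real_part (fixV foo)).
  by rewrite real_partK.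
exists d, (- b), (- c), a; split; first by rewrite -D; ring.
move=> t Ct.
have := fC _ (ex_intro2 _ _ t Ct erefl).
rewrite -real_partE ?fixV// homeoVK real_partE ?fixV//.
set u := real_part _ t; rewrite /=.
case: eqP => // /eqP nz [->].
have E : - c * ((a * u + b) / (c * u + d)) + a = (c * u + d)^-1.
  by rewrite -[RHS]mul1r -D; field.
rewrite E invr_eq0 (negbTE nz); congr fin.
transitivity ((a * d - b * c) * u); first by rewrite D mul1r.
by rewrite invrK; field.
Qed.

Lemma monodH_group_closed : group_closed monodH_pred.
Proof.
split=> [|f g fH gH]; last exact/monodH_mul/monodH_inv.
apply/monodHP; split=> //; apply/piecewise_mobiusP.
exists [::] => C _; exists 1, 0, 0, 1; split; first by ring.
by move=> t _; rewrite homeo1 /= mul0r add0r oner_eq0 mul1r addr0 divr1.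
Qed.

HB.instance Definition _ := SubChoice_isSubGroup.Build
  (homeo RP1) monodH_pred monodH monodH_group_closed.

End Monod.

(* Main.v *)
(* The real points fixed by z form a closed set with finite boundary.  If p is
   its least boundary point, every g commuting with z permutes the boundary
   points and is increasing, so g fixes p; as (-oo, p) and (p, +oo) are both
   identified with R by piecewise Mobius charts, C(z) is the product of the
   centralizers of the two halves of z, and induction applies.

   If z has no boundary point, either z = 1, and C(z) = H, or z moves every point
   in the same direction, say up.  Near -oo, z is then the time-one map of a
   one-parameter group of affine maps.  Conjugating by powers of z extends this
   group to a flow on R commuting with z, and every g in C(z) belongs to the flow,
   since its germ at -oo does.  Hence C(z) is the subgroup A of those s in R for
   which the time-s map lies in H.  The time-s maps can only fail to lie in H
   because of break points accumulating at +oo.  If A contains arbitrarily small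
   s > 0, a Mobius piece of the flow parametrization longer than s propagates to
   +oo by translations by s, so there are no such break points and A = R.
   Otherwise A is cyclic. *)
Require Import Defs.
From mathcomp Require Import all_boot all_order all_algebra.
From mathcomp Require Import all_classical all_reals all_analysis.
From mathcomp Require Import ring lra.
Set Implicit Arguments.
Unset Strict Implicit.
Unset Printing Implicit Defensive.
Import Order.TTheory GRing.Theory Num.Theory.
Import numFieldNormedType.Exports.
Local Open Scope classical_set_scope.
Local Open Scope ring_scope.

(** * Germs of Mobius maps at the cuts of the line *)

Section Cuts.
Variable R : realType.
Implicit Types (a b p t x y : R) (P Q : R -> Prop) (f g h : R -> R).

(* [Left x] and [Right x] are the punctured one-sided neighbourhoods of x, so
   that germs at a cut ignore the value at x. *)
Inductive cut := NInf | Left of R | Right of R | PInf.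
Implicit Types E : cut.

Definition ev E P : Prop :=
  match E with
  | NInf => exists y, forall t, t < y -> P t
  | Left x => exists2 y, y < x & forall t, y < t -> t < x -> P t
  | Right x => exists2 y, x < y & forall t, x < t -> t < y -> P t
  | PInf => exists y, forall t, y < t -> P t
  end.

Lemma evS E P Q : (forall t, P t -> Q t) -> ev E P -> ev E Q.
Proof.
move=> PQ; case: E => [|x|x|] /= => [[y Py]|[y yx Py]|[y yx Py]|[y Py]];
  exists y => //.
- by move=> t ty; apply/PQ/Py.
- by move=> t ty tx; apply/PQ/Py.
- by move=> t ty tx; apply/PQ/Py.
- by move=> t ty; apply/PQ/Py.
Qed.

Lemma evT E P : (forall t, P t) -> ev E P.
Proof.
move=> PT; case: E => [|x|x|] /=; first by exists 0.
- by exists (x - 1) => //; lra.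
- by exists (x + 1) => //; lra.
- by exists 0.
Qed.

Lemma evI E P Q : ev E P -> ev E Q -> ev E (fun t => P t /\ Q t).
Proof.
case: E => [|x|x|] /=.
- move=> [y Py] [y' Qy]; exists (Order.min y y') => t.
  by rewrite lt_min => /andP[ty ty']; split; [exact: Py|exact: Qy].
- move=> [y yx Py] [y' yx' Qy]; exists (Order.max y y').
    by rewrite gt_max yx.
  move=> t; rewrite gt_max => /andP[ty ty'] tx.
  by split; [exact: Py|exact: Qy].
- move=> [y yx Py] [y' yx' Qy]; exists (Order.min y y').
    by rewrite lt_min yx.
  move=> t tx; rewrite lt_min => /andP[ty ty'].
  by split; [exact: Py|exact: Qy].
- move=> [y Py] [y' Qy]; exists (Order.max y y') => t.
  by rewrite gt_max => /andP[ty ty']; split; [exact: Py|exact: Qy].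
Qed.

Lemma ev_open E P : ev E P ->
  ev E (fun t => exists a b, [/\ a < t, t < b & forall u, a < u -> u < b -> P u]).
Proof.
case: E => [|x|x|] /=.
- move=> [y Py]; exists y => t ty; exists (t - 1), y; split=> //; first by lra.
  by move=> u _; exact: Py.
- by move=> [y yx Py]; exists y => // t yt tx; exists y, x; split.
- by move=> [y yx Py]; exists y => // t yt tx; exists x, y; split.
- move=> [y Py]; exists y => t ty; exists y, (t + 1); split=> //; first by lra.
  by move=> u uy _; exact: Py.
Qed.

Lemma ev_interval E P : ev E P ->
  exists a b, a < b /\ forall t, a < t -> t < b -> P t.
Proof.
case: E => [|x|x|] /=.
- by move=> [y Py]; exists (y - 1), y; split=> [|t _]; [lra|exact: Py].
- by move=> [y yx Py]; exists y, x.
- by move=> [y yx Py]; exists x, y.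
- by move=> [y Py]; exists y, (y + 1); split=> [|t ty _]; [lra|exact: Py].
Qed.

Lemma ev_ex E P : ev E P -> exists t, P t.
Proof.
move=> /ev_interval[a [b [ab H]]]; exists ((a + b) / 2).
by apply: H; lra.
Qed.

(** Cuts lie between points, so every real number is strictly on one side of a cut; this includes a
    itself at [Left a] and [Right a]. *)
Lemma ev_side E a : ev E (fun t => a < t) \/ ev E (fun t => t < a).
Proof.
case: E => [|x|x|] /=.
- by right; exists a.
- have [xa|ax] := leP x a.
    by right; exists (x - 1) => [|t _ tx]; [lra|exact: lt_le_trans xa].
  by left; exists a.
- have [ax|xa] := leP a x.
    by left; exists (x + 1) => [|t xt _]; [lra|exact: le_lt_trans xt].
  by right; exists a.
- by left; exists a.
Qed.

Lemma ev_neq E a : ev E (fun t => t != a).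
Proof.
by case: (ev_side E a); apply: evS => t; [move/gt_eqF->|move/lt_eqF->].
Qed.

Definition inc f := {homo f : x y / x < y}.
(** For increasing maps this stands in for continuity. Unlike [surj], it also holds for charts onto
    half-lines and for orbits that are bounded above. *)
Definition conv f := forall a b y, f a < y -> y < f b -> exists x, f x = y.
Definition surj f := forall y, exists x, f x = y.

Lemma incP f : inc f -> {mono f : x y / x < y}.
Proof. by move=> fi; apply/leW_mono/le_mono. Qed.

Lemma inc_injective f : inc f -> injective f.
Proof. by move=> fi; apply/inc_inj/le_mono. Qed.

Lemma surj_conv f : surj f -> conv f.
Proof. by move=> fs a b y _ _; exact: fs. Qed.

Lemma inc_comp f g : inc f -> inc g -> inc (f \o g).
Proof. by move=> fi gi x y xy; apply/fi/gi. Qed.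

Lemma surj_comp f g : surj f -> surj g -> surj (f \o g).
Proof. by move=> fs gs y; have [x <-] := fs y; have [w <-] := gs x; exists w. Qed.

(** The filter at [E'] is exactly the image of the filter at [E], so germs can be both pulled back
    and pushed forward along [f]. *)
Definition carries f E E' := forall Q, ev E' Q <-> ev E (Q \o f).

Lemma carries_comp f g E E' E'' :
  carries f E E' -> carries g E' E'' -> carries (g \o f) E E''.
Proof.
move=> fE gE Q; split=> [/gE/fE//|].
by move=> H; apply/gE/fE.
Qed.

Lemma carries_right f x : inc f -> conv f -> carries f (Right x) (Right (f x)).
Proof.
move=> fi fc Q; split=> /= -[y xy Qy].
  have [yf|fy] := ltP y (f (x + 1)); last first.
    exists (x + 1); first by lra.
    by move=> t xt t1; apply: Qy; [exact: fi|apply: lt_le_trans fy; exact: fi].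
  have [y' E] := fc _ _ _ xy yf; subst y.
  exists y'; first by rewrite -(incP fi).
  by move=> t xt ty; apply: Qy; exact: fi.
exists (f y); first exact: fi.
move=> t xt ty; have [w E] := fc _ _ _ xt ty; subst t.
by apply: Qy; rewrite -(incP fi).
Qed.

Lemma carries_left f x : inc f -> conv f -> carries f (Left x) (Left (f x)).
Proof.
move=> fi fc Q; split=> /= -[y xy Qy].
  have [yf|fy] := ltP (f (x - 1)) y; last first.
    exists (x - 1); first by lra.
    by move=> t xt t1; apply: Qy; [apply: le_lt_trans fy _|]; exact: fi.
  have [y' E] := fc _ _ _ yf xy; subst y.
  exists y'; first by rewrite -(incP fi).
  by move=> t xt ty; apply: Qy; exact: fi.
exists (f y); first exact: fi.
move=> t xt ty; have [w E] := fc _ _ _ xt ty; subst t.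
by apply: Qy; rewrite -(incP fi).
Qed.

Lemma carries_PInf f : inc f -> conv f -> (forall y, exists x, y < f x) ->
  carries f PInf PInf.
Proof.
move=> fi fc fu Q; split=> /= -[y Qy].
  have [x yx] := fu y; exists x => t xt.
  by apply/Qy/(lt_trans yx)/fi.
exists (f y) => t yt; have [x tx] := fu t; have [w E] := fc _ _ _ yt tx.
by subst t; apply: Qy; rewrite -(incP fi).
Qed.

Lemma carries_NInf f : inc f -> conv f -> (forall y, exists x, f x < y) ->
  carries f NInf NInf.
Proof.
move=> fi fc fu Q; split=> /= -[y Qy].
  have [x yx] := fu y; exists x => t xt.
  by apply/Qy/(lt_trans _ yx)/fi.
exists (f y) => t yt; have [x tx] := fu t; have [w E] := fc _ _ _ tx yt.
by subst t; apply: Qy; rewrite -(incP fi).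
Qed.

Lemma carries_PInf_Left f p : inc f -> conv f -> (forall x, f x < p) ->
  (forall y, y < p -> exists x, y < f x) -> carries f PInf (Left p).
Proof.
move=> fi fc fp fu Q; split=> /= [[y yp Qy]|[y Qy]].
  have [x yx] := fu y yp; exists x => t xt.
  by apply: Qy => //; apply/(lt_trans yx)/fi.
exists (f y) => // t yt tp; have [x tx] := fu t tp.
have [w E] := fc _ _ _ yt tx.
by subst t; apply: Qy; rewrite -(incP fi).
Qed.

Lemma carries_NInf_Right f p : inc f -> conv f -> (forall x, p < f x) ->
  (forall y, p < y -> exists x, f x < y) -> carries f NInf (Right p).
Proof.
move=> fi fc fp fu Q; split=> /= [[y yp Qy]|[y Qy]].
  have [x yx] := fu y yp; exists x => t xt.
  by apply: Qy => //; apply/(lt_trans _ yx)/fi.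
exists (f y) => // t tp yt; have [x tx] := fu t tp.
have [w E] := fc _ _ _ tx yt.
by subst t; apply: Qy; rewrite -(incP fi).
Qed.

Definition push f E : cut :=
  match E with
  | NInf => NInf | Left x => Left (f x) | Right x => Right (f x) | PInf => PInf
  end.

Lemma carries_push f E : inc f -> surj f -> carries f E (push f E).
Proof.
move=> fi fs; have fc := surj_conv fs; case: E => [|x|x|] /=.
- by apply: carries_NInf => // y; have [x xE] := fs (y - 1); exists x; rewrite xE; lra.
- exact: carries_left.
- exact: carries_right.
- by apply: carries_PInf => // y; have [x xE] := fs (y + 1); exists x; rewrite xE; lra.
Qed.

Lemma push_surj f E : surj f -> exists E', E = push f E'.
Proof.
move=> fs; case: E => [|x|x|]; first by exists NInf.
- by have [y <-] := fs x; exists (Left y).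
- by have [y <-] := fs x; exists (Right y).
- by exists PInf.
Qed.

(** * Mobius relations, and Mobius equivalence of germs *)

Record mat := Mat { ma : R; mb : R; mc : R; md : R }.
Implicit Types M N : mat.

Definition det M := ma M * md M - mb M * mc M.
Definition mulm N M := Mat (ma N * ma M + mb N * mc M) (ma N * mb M + mb N * md M)
  (mc N * ma M + md N * mc M) (mc N * mb M + md N * md M).
Definition invm M := Mat (md M) (- mb M) (- mc M) (ma M).

(* y = (a x + b) / (c x + d) with the denominator cleared; when [det M != 0]
   this forces c x + d <> 0. *)
Definition mob M x y := y * (mc M * x + md M) = ma M * x + mb M.

Lemma det_mulm N M : det (mulm N M) = det N * det M.
Proof. by rewrite /det /=; ring. Qed.

Lemma det_invm M : det (invm M) = det M.
Proof. by rewrite /det /=; ring. Qed.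

Lemma mob_comp M N x y t : mob M x y -> mob N y t -> mob (mulm N M) x t.
Proof.
rewrite /mob /= => H1 H2.
set K := mc M * x + md M in H1 *; pose L := ma M * x + mb M.
transitivity (t * (mc N * L + md N * K)); first by rewrite /L /K; ring.
rewrite /L -H1; transitivity (t * (mc N * y + md N) * K); first by ring.
rewrite H2; transitivity (ma N * (y * K) + mb N * K); first by ring.
by rewrite H1 /K; ring.
Qed.

Lemma mob_inv M x y : mob M x y -> mob (invm M) y x.
Proof. by rewrite /mob /= => H; nra. Qed.

Lemma mob_den M x y : 0 < det M -> mob M x y -> mc M * x + md M != 0.
Proof.
rewrite /mob /det => D H; apply/eqP => E; move: H; rewrite E mulr0 => H.
have : ma M * (mc M * x + md M) - mc M * (ma M * x + mb M) = det M.
  by rewrite /det; ring.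
rewrite E -H /det !mulr0 subrr; lra.
Qed.

Lemma mob_fun M x y y' : 0 < det M -> mob M x y -> mob M x y' -> y = y'.
Proof.
move=> D H H'; apply: (mulIf (mob_den D H)).
by rewrite H H'.
Qed.

(** The relation is between the values of [f] and those of [g]. Thus [pm E] is an equivalence
    relation, and it can compare parametrizations, such as exponential orbits, that are not
    themselves Mobius. *)
Definition pm E f g := exists2 M, 0 < det M & ev E (fun t => mob M (f t) (g t)).

Lemma pm_eq E f g : ev E (fun t => f t = g t) -> pm E f g.
Proof.
move=> H; exists (Mat 1 0 0 1); first by rewrite /det /=; lra.
by apply: evS H => t ->; rewrite /mob /=; ring.
Qed.

Lemma pm_sym E f g : pm E f g -> pm E g f.
Proof.
move=> [M D H]; exists (invm M); first by rewrite det_invm.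
by apply: evS H => t; exact: mob_inv.
Qed.

Lemma pm_trans E f g h : pm E f g -> pm E g h -> pm E f h.
Proof.
move=> [M D H] [N D' H']; exists (mulm N M); first by rewrite det_mulm mulr_gt0.
by apply: evS (evI H H') => t [] ; exact: mob_comp.
Qed.

Lemma pm_comp E E' u f g : carries u E E' -> pm E' f g -> pm E (f \o u) (g \o u).
Proof. by move=> uE [M D H]; exists M => //; apply/(uE (fun t => mob M (f t) (g t))). Qed.

Lemma pm_comp_inv E E' u f g : carries u E E' -> pm E (f \o u) (g \o u) -> pm E' f g.
Proof. by move=> uE [M D H]; exists M => //; apply/(uE (fun t => mob M (f t) (g t))). Qed.

(** Monod's group read on the real line: a finite list of pieces is replaced by a Mobius germ at
    every cut, both ends of the line included. Composition then keeps no record of break points;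
    [monod_pieces] recovers the list. *)
Record monod f : Prop := Monod {
  monod_inc : inc f;
  monod_surj : surj f;
  monod_pm : forall E, pm E id f }.

Lemma monod_carries f E : monod f -> carries f E (push f E).
Proof. by move=> [fi fs _]; exact: carries_push. Qed.

Lemma monod_id : monod id.
Proof.
split=> // [y|E]; first by exists y.
by apply: pm_eq; apply: evT.
Qed.

Lemma monod_comp f g : monod f -> monod g -> monod (f \o g).
Proof.
move=> Hf Hg; have [fi fs fp] := Hf; have [gi gs gp] := Hg.
split; [exact: inc_comp|exact: surj_comp|move=> E].
apply: pm_trans (gp E) _.
exact: (pm_comp (monod_carries E Hg) (fp _)).
Qed.

Lemma monod_can f g : monod f -> cancel g f -> monod g.
Proof.
move=> Hf gK; have [fi fs fp] := Hf.
have fK : cancel f g by move=> x; apply: (inc_injective fi); rewrite gK.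
split.
- by move=> x y xy; rewrite -(incP fi) !gK.
- by move=> y; exists (f y); rewrite fK.
- move=> E; have [E' ->] := push_surj E fs.
  apply: (pm_comp_inv (monod_carries E' Hf)).
  apply: pm_sym; apply: pm_trans (pm_eq _) (fp E').
  by apply: evT => t /=; rewrite fK.
Qed.

Lemma surj_inv f : surj f -> exists g, cancel g f.
Proof. by move=> fs; have [g gK] := choice fs; exists g. Qed.

Lemma monod_inv f : monod f -> exists g, [/\ monod g, cancel f g & cancel g f].
Proof.
move=> Hf; have [g gK] := surj_inv (monod_surj Hf).
exists g; split=> //; first exact: monod_can gK.
by move=> x; apply: (inc_injective (monod_inc Hf)); rewrite gK.
Qed.

(** Continuous induction, used in place of compactness of intervals. If [P] failed somewhere, its
    supremum would satisfy [P] by the limit step and be exceeded by the last one. *)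
Lemma real_ind P :
  (exists x, P x) -> (forall x y, y <= x -> P x -> P y) ->
  (forall x, (forall y, y < x -> P y) -> P x) ->
  (forall x, P x -> exists2 y, x < y & P y) -> forall x, P x.
Proof.
move=> [x0 Px0] Pdown Plim Pstep x; apply: contrapT => nPx.
have ubx : ubound P x.
  by move=> y Py; rewrite leNgt; apply/negP => /ltW xy; exact/nPx/(Pdown _ _ xy).
have hs : has_sup P by split; [exists x0|exists x].
have [y sy Py] : exists2 y, sup P < y & P y.
  apply/Pstep/Plim => y ys.
  have sy : 0 < sup P - y by lra.
  have [w Pw yw] := sup_adherent sy hs.
  by apply: Pdown Pw; lra.
have := ub_le_sup hs.2 Py; lra.
Qed.

End Cuts.
Arguments NInf {R}.
Arguments PInf {R}.

(** * One-parameter groups near -oo and additive subgroups of the reals *)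

Section Flow.
Variable R : realType.
Implicit Types (a b p s t x y : R) (f g e : R -> R) (M N : mat R).

Lemma lt_below3 a b x : exists t, [/\ t < a, t < b & t < x].
Proof.
have [t [[/= ta tb] tx]] := ev_ex (evI (evI
  (ex_intro _ a (fun t ta => ta) : ev NInf (fun t => t < a))
  (ex_intro _ b (fun t ta => ta) : ev NInf (fun t => t < b)))
  (ex_intro _ x (fun t ta => ta) : ev NInf (fun t => t < x))).
by exists t.
Qed.

Lemma quadratic_eq0 a b c x1 x2 x3 : x2 != x1 -> x3 != x2 -> x3 != x1 ->
  a * x1 ^+ 2 + b * x1 + c = 0 -> a * x2 ^+ 2 + b * x2 + c = 0 ->
  a * x3 ^+ 2 + b * x3 + c = 0 -> forall x, a * x ^+ 2 + b * x + c = 0.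
Proof.
move=> x21 x32 x31 H1 H2 H3 x.
have E1 : a * (x1 + x2) + b = 0.
  apply: (@mulIf _ (x2 - x1)); first by rewrite subr_eq0.
  rewrite mul0r -[RHS](subrr 0) -{1}H2 -H1; ring.
have E2 : a * (x2 + x3) + b = 0.
  apply: (@mulIf _ (x3 - x2)); first by rewrite subr_eq0.
  rewrite mul0r -[RHS](subrr 0) -{1}H3 -H2; ring.
have a0 : a = 0.
  apply: (@mulIf _ (x3 - x1)); first by rewrite subr_eq0.
  rewrite mul0r -[RHS](subrr 0) -{1}E2 -E1; ring.
have b0 : b = 0 by move: E1; rewrite a0 mul0r add0r.
by move: H1; rewrite a0 b0 !mul0r !add0r.
Qed.

(** Cross-multiplying the two relations gives a quadratic polynomial in [f t]. It vanishes at three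
    distinct values, hence identically. *)
Lemma mob_ext M N f g a b : 0 < det N -> inc f -> a < b ->
  (forall t, a < t -> t < b -> mob M (f t) (g t)) ->
  (forall t, a < t -> t < b -> mob N (f t) (g t)) ->
  forall x y, mob N x y -> mob M x y.
Proof.
move=> DN fi ab HM HN x y Nxy.
(* A, B, C are the coefficients of (numerator of N)(denominator of M) - (numerator of M)(denominator
   of N). *)
pose A := ma N * mc M - ma M * mc N.
pose B := ma N * md M + mb N * mc M - ma M * md N - mb M * mc N.
pose C := mb N * md M - mb M * md N.
have q u v : mob N u v -> (A * u ^+ 2 + B * u + C =
    (v * (mc M * u + md M) - (ma M * u + mb M)) * (mc N * u + md N)).
  move=> H; transitivity ((ma N * u + mb N) * (mc M * u + md M) -
     (ma M * u + mb M) * (mc N * u + md N)); first by rewrite /A /B /C; ring.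
  by rewrite -H; ring.
have q0 t : a < t -> t < b -> A * f t ^+ 2 + B * f t + C = 0.
  by move=> at_ tb; rewrite (q _ (g t)); [rewrite HM// subrr mul0r|exact: HN].
pose t1 := a + (b - a) / 4; pose t2 := a + (b - a) / 2.
pose t3 := a + (b - a) * 3 / 4.
have := @quadratic_eq0 A B C (f t1) (f t2) (f t3).
move=> /(_ _ _ _ _ _ _ x).
rewrite (q _ _ Nxy) => H; apply/eqP; rewrite -subr_eq0; apply/eqP.
apply: (mulIf (mob_den DN Nxy)); rewrite mul0r; apply: H.
- by rewrite gt_eqF//; apply: fi; rewrite /t1 /t2; lra.
- by rewrite gt_eqF//; apply: fi; rewrite /t3 /t2; lra.
- by rewrite gt_eqF//; apply: fi; rewrite /t3 /t1; lra.
- by apply: q0; rewrite /t1; lra.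
- by apply: q0; rewrite /t2; lra.
- by apply: q0; rewrite /t3; lra.
Qed.

Definition cz z g := monod g /\ forall x, g (z x) = z (g x).

Lemma affine_at_NInf g : monod g ->
  exists a b, 0 < a /\ ev NInf (fun t => g t = a * t + b).
Proof.
move=> Hg; have [M D [X HX]] := monod_pm Hg NInf.
(* With c nonzero, (g t - a/c)(t + d/c) = - det / c^2 is negative. But near -oo both factors are
   negative, since [g] is increasing and takes the value a/c. *)
have c0 : mc M = 0.
  apply: contrapT => /eqP c0.
  have [t0 gt0] := monod_surj Hg (ma M / mc M).
  have [t [tX td /(monod_inc Hg)]] := lt_below3 X (- (md M / mc M)) t0.
  rewrite gt0 => gta; have := HX t tX; rewrite /mob /= => H.
  have : 0 < (g t - ma M / mc M) * (t - - (md M / mc M)) by nra.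
  have -> : (g t - ma M / mc M) * (t - - (md M / mc M)) = - det M / mc M ^+ 2.
    transitivity ((mc M * (g t * (mc M * t + md M)) - ma M * (mc M * t + md M)) / mc M ^+ 2).
      by field.
    by rewrite H /det; field.
  rewrite mulNr oppr_gt0 ltNge divr_ge0 ?sqr_ge0//; exact: ltW.
have d0 : md M != 0.
  by apply/eqP => d0; move: D; rewrite /det c0 d0; lra.
exists (ma M / md M), (mb M / md M); split.
  have -> : ma M / md M = det M / md M ^+ 2 by rewrite /det c0; field.
  by rewrite divr_gt0// exprn_even_gt0.
exists X => t /HX; rewrite /mob c0 mul0r add0r => H.
by apply: (mulIf d0); rewrite H; field.
Qed.

(* Near -oo, [z] is the time-one map of a one-parameter group of affine maps;
   [e] is an orbit of that group, parametrized by time. *)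
Lemma orbit_at_NInf z : monod z -> (forall x, x < z x) ->
  exists e, [/\ inc e, conv e, (forall y, exists x, e x < y),
    (forall s, exists2 M, 0 < det M & forall t, mob M (e t) (e (t + s))) &
    ev NInf (fun t => z (e t) = e (t + 1)) /\
    forall g, cz z g -> exists s, ev NInf (fun t => g (e t) = e (t + s))].
Proof.
move=> Hz zgt; have [al [be [al0 Zev]]] := affine_at_NInf Hz.
(* Near -oo both maps are affine; comparing the constant terms of g z and z g gives the last
   equation. *)
have cg g : cz z g -> exists a b, [/\ 0 < a, ev NInf (fun t => g t = a * t + b) &
    a * be + b = al * b + be].
  move=> [Hg gz]; have [a [b [a0 Gev]]] := affine_at_NInf Hg.
  exists a, b; split=> //.
  have := Gev; rewrite -[NInf]/(push z NInf) (monod_carries _ Hz) => Gz.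
  have := Zev; rewrite -[NInf]/(push g NInf) (monod_carries _ Hg) => Zg.
  have [t [[Gt Zt] [/= Gzt Zgt]]] := ev_ex (evI (evI Gev Zev) (evI Gz Zg)).
  have := gz t; rewrite Gzt Zgt Gt Zt; lra.
(* A slope above 1 would give z t < t for very negative t. *)
have al1 : al <= 1.
  rewrite leNgt; apply/negP => al1; have [X HX] := Zev.
  have [t [tX + _]] := lt_below3 X (- be / (al - 1)) 0.
  rewrite ltr_pdivlMr; last by lra.
  have := zgt t; rewrite HX//; lra.
(* With slope 1, [z] is the translation by [be] near -oo, and its orbit is t |-> be t. *)
have [al_eq1|al_neq1] := eqVneq al 1.
  subst al; have be0 : 0 < be.
    by have [t Zt] := ev_ex Zev; have := zgt t; rewrite Zt; lra.
  exists (fun t => be * t).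
  have ei : inc (fun t => be * t) by move=> x y xy; rewrite ltr_pM2l.
  have ec : conv (fun t => be * t).
    by move=> a b y _ _; exists (y / be); field; rewrite gt_eqF.
  have eN y : exists x, be * x < y.
    by exists ((y - 1) / be); rewrite mulrC divfK ?gt_eqF//; lra.
  have ev_e P : ev NInf P -> ev NInf (fun t => P (be * t)).
    by move/(carries_NInf ei ec eN).
  split=> //; first 1 last.
    split; first by apply: evS (ev_e _ Zev) => t ->; ring.
    move=> g /cg[a [b [a0 Gev ab]]].
    have a1 : a = 1 by apply: (mulIf (lt0r_neq0 be0)); lra.
    exists (b / be); apply: evS (ev_e _ Gev) => t ->; subst a; field.
    by rewrite gt_eqF.
  move=> s; exists (Mat 1 (be * s) 0 1); first by rewrite /det /=; lra.
  by move=> t; rewrite /mob /=; ring.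
have {al_neq1}al1 : al < 1 by rewrite lt_neqAle al_neq1.
(* With slope below 1, the affine germ of [z] fixes p = be / (1 - al) and contracts towards it, so
   an orbit is t |-> p - al^t. The germs commuting with it also fix p. *)
pose k := ln al; have k0 : k < 0 by rewrite /k ln_lt0 ?al0 ?al1.
have Ek : expR k = al by rewrite lnK ?posrE.
pose p := be / (1 - al); have pE : al * p + be = p by rewrite /p; field; lra.
have kn0 : k != 0 by rewrite lt_eqF.
exists (fun t => p - expR (k * t)).
have ei : inc (fun t => p - expR (k * t)).
  by move=> x y xy; rewrite ltrD2l ltrN2 ltr_expR ltr_nM2l.
have ln_e y : y < p -> p - expR (k * (ln (p - y) / k)) = y.
  by move=> yp; rewrite mulrCA divff// mulr1 lnK ?posrE; lra.
have ec : conv (fun t => p - expR (k * t)).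
  move=> a b y _ yb; exists (ln (p - y) / k); apply: ln_e.
  by have := expR_gt0 (k * b); lra.
have eN y : exists x, p - expR (k * x) < y.
  have [t [ty tp _]] := lt_below3 y p 0.
  by exists (ln (p - t) / k); rewrite ln_e.
have ev_e P : ev NInf P -> ev NInf (fun t => P (p - expR (k * t))).
  by move/(carries_NInf ei ec eN).
split=> //; first 1 last.
  split.
    apply: evS (ev_e _ Zev) => t ->; rewrite (mulrDr k) mulr1 expRD Ek.
    by rewrite -{2}pE; ring.
  move=> g /cg[a [b [a0 Gev ab]]].
  exists (ln a / k); apply: evS (ev_e _ Gev) => t ->.
  rewrite (mulrDr k) expRD (mulrCA k) divff// mulr1 lnK ?posrE//.
  have -> : b = p * (1 - a).
    have n0 : 1 - al != 0 by rewrite gt_eqF; lra.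
    by apply: (mulIf n0); rewrite /p mulrAC divfK//; lra.
  by ring.
move=> s; exists (Mat (expR (k * s)) (p * (1 - expR (k * s))) 0 1).
  by rewrite /det /= mulr1 mulr0 subr0 expR_gt0.
by move=> t; rewrite /mob /= (mulrDr k) expRD; ring.
Qed.

(** Without arbitrarily small positive elements, the infimum of the positive elements is attained,
    and Euclidean division shows that it generates. *)
Lemma additive_subgroup_dichotomy (A : R -> Prop) : A 1 ->
  (forall s t, A s -> A t -> A (s - t)) ->
  (forall d, 0 < d -> exists s, [/\ 0 < s, s < d & A s]) \/
  exists2 s0, 0 < s0 & forall s, A s <-> exists k : int, s = s0 * k%:~R.
Proof.
move=> A1 AB.
have A0 : A 0 by rewrite -(subrr 1); exact: AB.
have AN s : A s -> A (- s) by move=> As; rewrite -sub0r; exact: AB.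
have AD s t : A s -> A t -> A (s + t).
  by move=> As At; rewrite -[t]opprK; apply/AB/AN.
have [|/existsNP[d /not_implyP[d0 nd]]] := pselect
  (forall d, 0 < d -> exists s, [/\ 0 < s, s < d & A s]); first by left.
have {}nd s : 0 < s -> A s -> d <= s.
  by move=> s0 As; rewrite leNgt; apply/negP => sd; apply: nd; exists s.
right; pose S : set R := [set s | 0 < s /\ A s].
have hS : has_inf S.
  by split; [exists 1; split=> //; lra|exists d => s [s0 As]; exact: nd].
have [a [a0 Aa] ad] := inf_adherent d0 hS.
have iS s : S s -> inf S <= s by move=> Ss; exact: ge_inf hS.2 _ Ss.
have da : d <= inf S by apply: lb_le_inf hS.1 _ => s [s0 As]; exact: nd.
(* Otherwise another positive element a' lies between the infimum and a, and a - a' is a positive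
   element below d. *)
have aE : a = inf S.
  apply/eqP; rewrite eq_le iS// andbT leNgt; apply/negP => Sa.
  have e0 : 0 < a - inf S by lra.
  have [a' [a'0 Aa']] := inf_adherent e0 hS.
  have := iS a' (conj a'0 Aa').
  have := nd (a - a') _ (AB _ _ Aa Aa'); lra.
have Ak (k : int) : A (a * k%:~R).
  have An (n : nat) : A (a * n%:R).
    elim: n => [|n IH]; first by rewrite mulr0.
    by rewrite mulrSr mulrDr mulr1; exact: AD.
  case: k => n; first exact: An.
  by rewrite NegzE mulrNz mulrN; apply/AN/An.
exists a => // s; split=> [As|[k ->]]; last exact: Ak.
exists (Num.floor (s / a)); set k := Num.floor _.
have := floor_le (s / a); rewrite -/k ler_pdivlMr// => H1.
have := floorD1_gt (s / a); rewrite -/k ltr_pdivrMr// intrD => H2.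
have Ar : A (s - a * k%:~R) by exact: AB.
have [r0|r0|r0] := ltgtP 0 (s - a * k%:~R).
- have := iS _ (conj r0 Ar); rewrite -aE; lra.
- lra.
- by lra.
Qed.

End Flow.

(** * The flow of a fixed-point-free element *)

Lemma nat_gt (R : realType) (x : R) : exists n : nat, x < n%:R.
Proof.
exists (Num.bound `|x|).
exact: le_lt_trans (ler_norm _) (archi_boundP (normr_ge0 _)).
Qed.

Section Translation.
Variable R : realType.
Variables (z e : R -> R) (T : R).
Hypothesis Hz : monod z.
Hypothesis zgt : forall x, x < z x.
Hypothesis ei : inc e.
Hypothesis ec : conv e.
Hypothesis eN : forall y, exists x, e x < y.
Hypothesis eM : forall s, exists2 M, 0 < det M & forall t, mob M (e t) (e (t + s)).
Hypothesis ez : forall t, t < T -> z (e t) = e (t + 1).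
Implicit Types (E : cut R) (s t x y : R).

Lemma monod_iter n : monod (iter n z).
Proof.
elim: n => [|n IH]; first exact: monod_id.
exact: monod_comp Hz IH.
Qed.

(** Raising n by one leaves the right-hand side unchanged, by [ez]. So the orbit [e], known to
    follow [z] only before time T, continues consistently to all times. *)
Lemma exists_translation : exists psi : R -> R,
  forall n t, t - n%:R < T -> psi t = iter n z (e (t - n%:R)).
Proof.
have step n k t : t - n%:R < T ->
    iter (n + k) z (e (t - (n + k)%:R)) = iter n z (e (t - n%:R)).
  move=> tT; elim: k => [|k IH]; first by rewrite addn0.
  rewrite addnS iterSr ez -?IH; last first.
    by have := ler0n R k; rewrite -addSn addSnnS natrD -addn1 natrD; lra.
  by congr (iter _ z (e _)); rewrite -addn1 [(_ + 1)%:R]natrD; lra.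
suff /choice[psi Hpsi] : forall t, exists y, forall n, t - n%:R < T ->
    y = iter n z (e (t - n%:R)) by exists psi => n t; exact: Hpsi.
move=> t; have [N TN] := nat_gt (t - T).
have tN : t - N%:R < T by lra.
exists (iter N z (e (t - N%:R))) => n tn.
have [nN|Nn] := leqP n N.
  by rewrite -(subnKC nN) step.
by rewrite -(subnKC (ltnW Nn)) step.
Qed.

Variable psi : R -> R.
Hypothesis psiE : forall n t, t - n%:R < T -> psi t = iter n z (e (t - n%:R)).

Let small2 t t' : exists n : nat, t - n%:R < T /\ t' - n%:R < T.
Proof.
have [n] := nat_gt (Order.max (t - T) (t' - T)).
by rewrite gt_max => /andP[? ?]; exists n; split; lra.
Qed.

Lemma translationS t : psi (t + 1) = z (psi t).
Proof.
have [n [tn _]] := small2 t t.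
have E : t + 1 - n.+1%:R = t - n%:R by rewrite -addn1 natrD; lra.
by rewrite (psiE tn) (psiE (n := n.+1)) E.
Qed.

Lemma translation_inc : inc psi.
Proof.
move=> x y xy; have [n [xn yn]] := small2 x y.
rewrite (psiE xn) (psiE yn); apply/(monod_inc (monod_iter n))/ei; lra.
Qed.

(** The iterates of y under the inverse of [z] drop below [e T]: otherwise they would have an
    infimum, which [z] moves up past some iterate, and the next iterate would lie below the infimum.
    Once there, they are in the range of [e]. *)
Lemma translation_surj : surj psi.
Proof.
move=> y; have [zi [Hzi zK ziK]] := monod_inv Hz.
have [n yn] : exists n, iter n zi y < e T.
  apply: contrapT => /forallNP nex.
  pose S : set R := range (fun n => iter n zi y).
  have hS : has_inf S.
    split; first by exists y; exists 0%N.
    exists (e T) => _ [n _ <-]; rewrite leNgt; apply/negP; exact: nex.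
  have d0 : 0 < z (inf S) - inf S by have := zgt (inf S); lra.
  have [_ [n _ <-] xS] := inf_adherent d0 hS.
  have : inf S <= iter n.+1 zi y by apply: ge_inf hS.2 _ _; exists n.+1.
  rewrite leNgt => /negP; apply; rewrite -(incP (monod_inc Hz)) ziK.
  by rewrite -[ltLHS]/(iter n zi y); move: xS => /=; lra.
have [t0 et0] := eN (iter n zi y).
have [t et] := ec et0 yn.
have tT : t < T by rewrite -(incP ei) et.
exists (t + n%:R); rewrite (psiE (n := n)) addrK// et.
by elim: (n) => // m IH; rewrite iterSr /= ziK.
Qed.

(** Near a cut other than [PInf] a single n serves in [psiE], so [psi] is a Mobius germ applied to
    the orbit shifted by -n, which [eM] relates to [e]. Towards [PInf] n grows without bound and
    break points may accumulate. *)
Lemma translation_pm E : E <> PInf -> pm E e psi.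
Proof.
move=> EP; have [n En] : exists n : nat, ev E (fun t => t - n%:R < T).
  case: E EP => // [_|x _|x _].
  - by exists 0%N; exists T => t; rewrite subr0.
  - have [n [xn _]] := small2 x x; exists n.
    by exists (x - 1) => [|t _ tx]; lra.
  - have [n [xn _]] := small2 x x; exists n.
    by exists (T + n%:R) => [|t _ tx]; lra.
have [E' eE'] : exists E', carries (fun t => e (t - n%:R)) E E'.
  have si : inc (fun t => t - n%:R) by move=> x y xy; lra.
  have ss : surj (fun t => t - n%:R) by move=> y; exists (y + n%:R); lra.
  have sE := carries_push E si ss.
  have [E'' eE''] : exists E'', carries e (push (fun t => t - n%:R) E) E''.
    case: E EP {En sE} => //= [_|x _|x _].
    - by exists NInf; exact: carries_NInf.
    - by eexists; exact: carries_left.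
    - by eexists; exact: carries_right.
  by exists E''; exact: carries_comp sE eE''.
have [M DM HM] := eM (- n%:R).
apply: (@pm_trans _ _ _ (fun t => e (t - n%:R))); first by exists M => //; exact: evT.
apply: pm_trans (pm_comp eE' (monod_pm (monod_iter n) E')) _.
by apply/pm_eq/(evS _ En) => t tn /=; rewrite (psiE tn).
Qed.

Variable chi : R -> R.
Hypothesis psiK : cancel psi chi.
Hypothesis chiK : cancel chi psi.

Definition flow s x := psi (chi x + s).

Lemma flowE s t : flow s (psi t) = psi (t + s).
Proof. by rewrite /flow psiK. Qed.

Lemma flowD s t x : flow (s + t) x = flow s (flow t x).
Proof. by rewrite [flow t x]/flow flowE -addrA (addrC t). Qed.

Lemma flow_inj s t : flow s (psi 0) = flow t (psi 0) -> s = t.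
Proof. by rewrite !flowE !add0r => /(inc_injective translation_inc). Qed.

Lemma flow1 : flow 1 =1 z.
Proof. by move=> x; rewrite /flow translationS chiK. Qed.

Lemma flow_commute s x : flow s (z x) = z (flow s x).
Proof. by rewrite -!flow1 -!flowD addrC. Qed.

Lemma flow_cz s : monod (flow s) -> cz z (flow s).
Proof. by move=> Hs; split=> // x; exact: flow_commute. Qed.

(** Read through [psi], the flow is the shift by s. Replacing [psi] by [e] on both sides with the
    relation [pm] leaves the shift along [e], which is Mobius by [eM]. *)
Lemma monod_flow s : pm PInf e psi -> monod (flow s).
Proof.
move=> pP; have pE E : pm E e psi.
  by case: E => [|x|x|] //; exact: translation_pm.
have psi_i := translation_inc; have psi_s := translation_surj.
have chi_i : inc chi by move=> x y xy; rewrite -(incP psi_i) !chiK.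
have si : inc (fun t => t + s) by move=> x y xy; lra.
have ss : surj (fun t => t + s) by move=> y; exists (y - s); lra.
split.
- by move=> x y xy; apply/psi_i/si/chi_i.
- by move=> y; exists (psi (chi y - s)); rewrite flowE subrK chiK.
- move=> E; have [E' ->] := push_surj E psi_s.
  apply: (pm_comp_inv (carries_push E' psi_i psi_s)).
  apply: pm_trans (pm_sym (pE E')) _.
  have [M DM HM] := eM s.
  apply: (@pm_trans _ _ _ (fun t => e (t + s))).
    by exists M => //; apply: evT.
  apply: pm_trans (pm_comp (carries_push E' si ss) (pE _)) _.
  by apply/pm_eq/evT => t /=; rewrite flowE.
Qed.

(** A map commuting with [z] is determined by its germ at -oo, since negative powers of [z] bring
    every point there. *)
Lemma cz_flow g : (exists s, ev NInf (fun t => g (e t) = e (t + s))) ->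
  cz z g -> exists s, g = flow s.
Proof.
move=> [s [Y HY]] [Hg gz]; exists s; apply/funext => x; rewrite -[x]chiK flowE.
(* Below m the germ identity [HY] holds, and [psi] is given by [e] at both times t - n and t - n +
   s. *)
set t := chi x; pose m := Order.min Y (Order.min T (T - s)).
have [n mn] := nat_gt (t - m).
have tn : t - n%:R < m by lra.
move: tn; rewrite !lt_min => /and3P[tY tT tsT].
have gi k y : g (iter k z y) = iter k z (g y).
  by elim: k => //= k IH; rewrite gz IH.
rewrite (psiE (n := n)) // gi HY //.
by rewrite (psiE (n := n)) //; [congr (iter _ z (e _))|]; lra.
Qed.

Lemma small_flow_pm :
  (forall d, 0 < d -> exists s, [/\ 0 < s, s < d & monod (flow s)]) ->
  pm PInf e psi.
Proof.
move=> small; have psi_i := translation_inc; have psi_s := translation_surj.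
(* Beyond X, [z] is the single Mobius map [Mz]; [psi] reaches X at time t0. *)
have [Mz DMz [X HX]] := monod_pm Hz PInf.
have [t0 t0X] := psi_s X.
have [M0 DM0 [b t0b HM0]] : pm (Right t0) e psi by exact: translation_pm.
(* Repeated application of [z] carries the piece on ]t0, b[ to ]t0 + n, b + n[. It remains a single
   piece because [psi] stays above X there. *)
have Mn (n : nat) : exists2 M, 0 < det M & forall t,
    t0 + n%:R < t -> t < b + n%:R -> mob M (e t) (psi t).
  elim: n => [|n [M DM IH]].
    by exists M0 => // t; rewrite !addr0; exact: HM0.
  have [N DN HN] := eM (-1).
  exists (mulm Mz (mulm M N)); first by rewrite !det_mulm !mulr_gt0.
  move=> t; rewrite -addn1 natrD => t1 t2.
  have tE : t = t - 1 + 1 by lra.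
  apply: (@mob_comp _ _ _ _ (psi (t - 1))); last first.
    rewrite {2}tE translationS; apply: HX; rewrite -t0X; apply: psi_i.
    by have := ler0n R n; lra.
  by apply: mob_comp (HN t) _; apply: IH; lra.
(* The time s is chosen shorter than the piece; beyond Y, [flow s] is the single map N. *)
have [s [s0 sb /monod_pm/(_ PInf)[N DN [Y HN]]]] := small (b - t0) ltac:(lra).
have [tY tYE] := psi_s Y.
have [n Yn] := nat_gt (tY - t0).
have nY : tY < t0 + n%:R by lra.
have [M DM HM] := Mn n; move: HM.
set a := t0 + n%:R in nY *; set c := b + n%:R => HM.
have ac : a + s < c by rewrite /a /c; lra.
have [F DF HF] := eM (- s).
(* K moves the piece M by time s: shift back along [e], apply M, then apply [flow s]. *)
pose K := mulm N (mulm M F).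
have HK t : a < t - s -> mob M (e (t - s)) (psi (t - s)) -> mob K (e t) (psi t).
  move=> at_ Mt; apply: (mob_comp (mob_comp (HF t) Mt)).
  have := HN (psi (t - s)); rewrite /= flowE subrK; apply.
  by rewrite -tYE; apply: psi_i; lra.
(* The window ]a, c[ is longer than s, so it overlaps its translate in ]a + s, c[. Both K and M
   relate [e] to [psi] there, and [mob_ext] applies. *)
have KM x y : mob K x y -> mob M x y.
  apply: (@mob_ext _ M K e psi (a + s) c) => //.
  - by rewrite !det_mulm !mulr_gt0.
  - by move=> t ta tc; apply: HM; lra.
  - by move=> t ta tc; apply: HK; [lra|apply: HM; lra].
(* Each translation by s prolongs the range of M by s. *)
have all (k : nat) t : a < t -> t < c + s * k%:R -> mob M (e t) (psi t).
  elim: k t => [|k IH] t at_ tc.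
    by apply: HM => //; move: tc; rewrite mulr0 addr0.
  have [tc'|ct] := ltP t c; first exact: HM.
  apply/KM/HK; first by lra.
  apply: IH; first by lra.
  by move: tc; rewrite -addn1 natrD; lra.
exists M => //; exists a => t at_.
have [k] := nat_gt ((t - c) / s).
by rewrite ltr_pdivrMr// => tk; apply: (all k) => //; lra.
Qed.

End Translation.

(** * The centralizer of a fixed-point-free element as a group of times *)

Section FreeCentralizer.
Variable R : realType.

Lemma centralizer_fixpoint_free (z : R -> R) : monod z -> (forall x, x < z x) ->
  exists phi : R -> R -> R,
    [/\ forall s t, phi (s + t) = phi s \o phi t, injective phi &
      (forall g, cz z g <-> exists s, g = phi s) \/
      exists2 s0, s0 != 0 & forall g, cz z g <-> exists k : int, g = phi (s0 * k%:~R)].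
Proof.
move=> Hz zgt; have [e [ei ec eN eM [[T ez] ecz]]] := orbit_at_NInf Hz zgt.
have [psi psiE] := exists_translation ez.
have psi_i := translation_inc Hz ei psiE.
have psi_s := translation_surj Hz zgt ei ec eN psiE.
have [chi chiK] := surj_inv psi_s.
have psiK : cancel psi chi by move=> t; apply: (inc_injective psi_i); rewrite chiK.
pose phi := flow psi chi; exists phi.
have phiD s t : phi (s + t) = phi s \o phi t.
  by apply/funext => x; exact: flowD.
have phi_cz g : cz z g <-> exists2 s, g = phi s & monod (phi s).
  split=> [gz|[s -> Hs]]; last exact (flow_cz psiE psiK chiK Hs).
  have [s gE] := cz_flow psiE psiK chiK (ecz _ gz) gz.
  by exists s => //; rewrite /phi -gE; case: gz.
split=> //.
  by move=> s t st; apply: (flow_inj Hz ei psiE psiK); rewrite -/phi st.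
have [||small|[s0 s0gt As0]] := @additive_subgroup_dichotomy R (fun s => monod (phi s)).
- by rewrite (_ : phi 1 = z)//; apply/funext => x; exact (flow1 psiE chiK x).
- move=> s t Hs Ht; rewrite phiD; apply: monod_comp => //.
  apply: (monod_can Ht) => x.
  by rewrite -[phi t _]/((phi t \o phi (- t)) x) -phiD subrr /phi /flow addr0 chiK.
- left=> g; rewrite phi_cz; split=> [[s -> _]|[s ->]]; first by exists s.
  exists s => //; apply: (monod_flow Hz zgt ei ec eN eM psiE psiK chiK).
  exact: (small_flow_pm Hz zgt ei ec eN eM psiE psiK small).
- right; exists s0; first by rewrite gt_eqF.
  move=> g; rewrite phi_cz; split=> [[s -> /As0[k ->]]|[k ->]]; first by exists k.
  by exists (s0 * k%:~R) => //; apply/As0; exists k.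
Qed.

End FreeCentralizer.

(** * Monod's group in terms of germs *)

Section Transfer.
Variable R : realType.
Implicit Types (E : cut R) (a b t x y : R) (f g : R -> R) (M : mat R).

(** The difference y' - y times both denominators is det M (x' - x), so the map increases on each
    side of its pole. *)
Lemma mob_lt M x x' y y' : 0 < det M -> mob M x y -> mob M x' y' ->
  0 < (mc M * x + md M) * (mc M * x' + md M) -> x < x' -> y < y'.
Proof.
move=> D H H' P xx'; rewrite -subr_gt0 -(pmulr_lgt0 _ P).
have -> : (y' - y) * ((mc M * x + md M) * (mc M * x' + md M)) = det M * (x' - x).
  transitivity ((y' * (mc M * x' + md M)) * (mc M * x + md M) -
    (y * (mc M * x + md M)) * (mc M * x' + md M)); first by ring.
  by rewrite H H' /det; ring.
by rewrite mulr_gt0// subr_gt0.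
Qed.

Lemma mob_real_part (F : homeo (RP1 R)) a b c d t : F (infty R) = infty R ->
  F (fin t) = mobius a b c d (fin t) -> mob (Mat a b c d) t (real_part F t).
Proof.
move=> Foo; rewrite real_partE//= /mob /=; case: eqP => // /eqP n0 [->].
by rewrite divfK.
Qed.

(** The set consists of the points lying on the same side as [E] of every a in s. *)
Lemma ev_unstraddled E (s : seq R) :
  exists2 C : set R, ev E C & forall a, a \in s -> ~ straddled C a.
Proof.
pose P a t := (ev E (fun u => a < u) -> a < t) /\ (ev E (fun u => u < a) -> t < a).
have PE a : ev E (P a).
  have excl : ev E (fun u => a < u) -> ev E (fun u => u < a) -> False.
    by move=> H1 H2; have [t [/= ? ?]] := ev_ex (evI H1 H2); lra.
  case: (ev_side E a) => H; apply: evS (H) => t at_; split=> // H'.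
    by case: (excl H H').
  by case: (excl H' H).
exists [set t | forall a, a \in s -> P a t].
  elim: s => [|a s IH]; first exact: evT.
  apply: evS (evI (PE a) IH) => t [Pa Ps] a'.
  by rewrite inE => /predU1P[->//|]; exact: Ps.
move=> a as_ [x [y [Cx Cy xa ay]]].
case: (ev_side E a) => H.
  by have [/(_ H) ? _] := Cx a as_; lra.
by have [_ /(_ H) ?] := Cy a as_; lra.
Qed.

Lemma monod_real_part (h : monodH R) : monod (real_part h).
Proof.
case: h => F /= FH; have /monodHP[Foo /piecewise_mobiusP[s Hs]] := FH.
have pmF E : pm E id (real_part F).
  have [C CE nC] := ev_unstraddled E s.
  have [a [b [c [d [D H]]]]] := Hs C nC.
  exists (Mat a b c d); first by rewrite /det /= D.
  by apply: evS CE => t /H; exact: mob_real_part.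
split=> //; last first.
  move=> y; exists (real_part (F^-1)%g y).
  by have := real_partK (fixV Foo) y; rewrite invgK.
have H : {within [set` `]-oo, +oo[%R], continuous (real_part F)}.
  by apply: continuous_subspaceT; exact: real_part_continuous.
have [||fm|fm] := @itv_continuous_inj_mono R (real_part F) `]-oo, +oo[%R.
- exact: H.
- by move=> x y _ _; exact: real_part_inj.
- by move=> x y xy; rewrite (leW_mono_in (le_mono_in fm)) ?in_itv.
(* A decreasing map is excluded by three equally spaced points near -oo. The middle denominator is
   the mean of the outer two and nonzero, so it has the sign of one of them, and [mob_lt] makes the
   map increase between those two points. *)
exfalso; have [M D [X HX]] := pmF NInf.
have dec x y : x < y -> real_part F y < real_part F x.
  by move=> xy; rewrite (leW_nmono_in (le_nmono_in fm)) ?in_itv.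
have contra x y : x < y -> y < X ->
    0 < (mc M * x + md M) * (mc M * y + md M) -> False.
  move=> xy yX P; have xX : x < X by lra.
  have := mob_lt D (HX x xX) (HX y yX) P xy.
  by have := dec _ _ xy; lra.
have nz x : x < X -> mc M * x + md M != 0 by move/HX/(mob_den D).
have h3 : X - 3 < X by lra.
have h2 : X - 2 < X by lra.
have h1 : X - 1 < X by lra.
have := nz _ h3; have := nz _ h2; have := nz _ h1.
have := @contra (X - 3) (X - 2); have := @contra (X - 2) (X - 1).
have : mc M * (X - 3) + md M + (mc M * (X - 1) + md M) = 2 * (mc M * (X - 2) + md M).
  by ring.
set d3 := _ + md M; set d1 := _ * (X - 1) + md M; set d2 := mc M * (X - 2) + md M.
move=> dE c12 c23.
have {c12} : d2 * d1 <= 0 by rewrite leNgt; apply/negP; apply: c12; lra.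
have {c23} : d3 * d2 <= 0 by rewrite leNgt; apply/negP; apply: c23; lra.
move=> P32 P21 n1 n2 n3; have : 0 < d2 ^+ 2 by rewrite exprn_even_gt0.
have : 2 * d2 ^+ 2 = d3 * d2 + d2 * d1.
  by rewrite expr2 mulrA -dE; ring.
lra.
Qed.

Lemma monod_continuous f : inc f -> surj f -> continuous f.
Proof.
move=> fi fs x; apply/cvgrPdist_lt => eps eps0.
have [a fa] := fs (f x - eps); have [b fb] := fs (f x + eps).
have ax : a < x by rewrite -(incP fi) fa; lra.
have xb : x < b by rewrite -(incP fi) fb; lra.
near=> t.
have at_ : f a < f t by apply: fi; near: t; exact: lt_nbhsr.
have tb : f t < f b by apply: fi; near: t; exact: lt_nbhsl.
by rewrite ltr_norml; apply/andP; split; lra.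
Unshelve. all: by end_near. Qed.

Lemma omap_continuous f g : continuous f -> continuous g -> cancel f g ->
  cancel g f -> continuous (omap f : RP1 R -> RP1 R).
Proof.
move=> cf cg fK gK [x|] U.
  exact: (cf x (Some @^-1` U)).
(* Neighbourhoods of infinity are given by complements of closed compact sets W. The preimage of W
   is compact because it is the image of W under [g]. *)
move=> [W [cW clW] WU]; exists (f @^-1` W).
  split.
    have -> : f @^-1` W = g @` W.
      apply/seteqP; split=> [t Wt|_ [w Ww <-]] /=; last by rewrite gK.
      by exists (f t).
    by apply: continuous_compact => //; exact: continuous_subspaceT.
  by apply: preimage_closed clW => x _; exact: cf.
move=> _ [[t Wt <-]|->]; apply: WU; [left|by right].
by exists (f t).
Qed.

Lemma continuous_eq0_closure (k : R -> R) a b : continuous k -> a < b ->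
  (forall t, a < t -> t < b -> k t = 0) -> forall t, a <= t <= b -> k t = 0.
Proof.
move=> ck ab k0 t /andP[at_ tb]; apply: contrapT => /eqP kt.
have /nbhs_ballP[eps eps0 H] : nbhs t (fun x => k x != 0) by exact: cvgr_neq0 (ck t) kt.
have eps0' : 0 < eps by [].
have [u [au ub ut]] : exists u, [/\ a < u, u < b & `|t - u| < eps].
  have [ta|ta] := eqVneq t a.
    subst t; pose v := Order.min eps (b - a) / 2.
    have v0 : 0 < v by rewrite divr_gt0// lt_min eps0' subr_gt0.
    have [v1 v2] : v * 2 <= eps /\ v * 2 <= b - a.
      by rewrite divfK ?pnatr_eq0// !ge_min !lexx orbT.
    by exists (a + v); split; [lra..|rewrite ltr_norml; apply/andP; split; lra].
  have at' : a < t by rewrite lt_neqAle eq_sym ta.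
  pose v := Order.min eps (t - a) / 2.
  have v0 : 0 < v by rewrite divr_gt0// lt_min eps0' subr_gt0.
  have [v1 v2] : v * 2 <= eps /\ v * 2 <= t - a.
    by rewrite divfK ?pnatr_eq0// !ge_min !lexx orbT.
  by exists (t - v); split; [lra..|rewrite ltr_norml; apply/andP; split; lra].
by have /eqP := H u ut; rewrite k0.
Qed.

Definition mob_on f (C : set R) := exists2 M, 0 < det M & forall t, C t -> mob M t (f t).

Lemma mob_on_closure f a b : continuous f -> a < b ->
  (exists2 M, 0 < det M & forall t, a < t -> t < b -> mob M t (f t)) ->
  mob_on f `[a, b].
Proof.
move=> cf ab [M D H]; exists M => // t; rewrite /= in_itv /= => tab.
apply/eqP; rewrite -subr_eq0; apply/eqP.
apply: (@continuous_eq0_closure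
  (fun t => f t * (mc M * t + md M) - (ma M * t + mb M)) a b) => //.
  move=> x; apply: cvgB; [apply: cvgM; first exact: cf|];
    by apply: cvgD; [apply: cvgMr; exact: cvg_id|exact: cvg_cst].
by move=> u au ub; rewrite H// subrr.
Qed.

Lemma mob_onS f (A B : set R) : A `<=` B -> mob_on f B -> mob_on f A.
Proof. by move=> AB [M D H]; exists M => // t /AB/H. Qed.

(** Continuous induction on x builds the break points for the part of the line up to x; the two
    one-sided germs at x supply the limit step and the extension step. *)
Lemma monod_pieces f : monod f -> exists s : seq R, forall C : set R,
  (forall a, a \in s -> ~ straddled C a) -> mob_on f C.
Proof.
move=> [fi fs fp]; have cf := monod_continuous fi fs.
have Q x : exists s : seq R, forall C : set R, C `<=` `]-oo, x] ->
    (forall a, a \in s -> ~ straddled C a) -> mob_on f C.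
  elim/real_ind: x.
  - have [M D [y HM]] := fp NInf; exists (y - 1), [::] => C Cy _.
    by exists M => // t /Cy; rewrite /= in_itv /= => ty; apply: HM; lra.
  - move=> x y yx [s Hs]; exists s => C Cy; apply: Hs => t /Cy.
    by rewrite /= !in_itv /= => /le_trans; exact.
  (* The left germ at x gives one piece on [y, x], its end values filled in by continuity, and y
     joins the break points. *)
  - move=> x IH; have [M D [y yx HM]] := fp (Left x).
    have [s Hs] := IH y yx; exists (y :: s) => C Cx nC.
    have [Cy|Cy] := not_straddled (nC y (mem_head _ _)).
      by apply: Hs => // a as_; apply: nC; rewrite inE as_ orbT.
    apply: mob_onS (mob_on_closure cf yx (ex_intro2 _ _ M D HM)) => t Ct.
    by move: (Cx t Ct) (Cy t Ct); rewrite /= !in_itv /= andbT => -> ->.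
  - move=> x [s Hs]; have [M D [y xy HM]] := fp (Right x).
    exists y => //; exists (x :: s) => C Cy nC.
    have [Cx|Cx] := not_straddled (nC x (mem_head _ _)).
      by apply: Hs => // a as_; apply: nC; rewrite inE as_ orbT.
    apply: mob_onS (mob_on_closure cf xy (ex_intro2 _ _ M D HM)) => t Ct.
    by move: (Cx t Ct) (Cy t Ct); rewrite /= !in_itv /= andbT => -> ->.
(* The cut is at y + 1 because the last piece is closed, while [HM] holds only strictly above y. *)
have [M D [y HM]] := fp PInf; have [s Hs] := Q (y + 1).
exists (y + 1 :: s) => C nC.
have [Cy|Cy] := not_straddled (nC (y + 1) (mem_head _ _)).
  by apply: Hs => // a as_; apply: nC; rewrite inE as_ orbT.
exists M => // t /Cy; rewrite /= in_itv /= andbT => yt; apply: HM; lra.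
Qed.

(** Dividing the matrix by the square root of its determinant normalizes the determinant to 1. *)
Lemma mob_on_mobius f C : mob_on f C -> mobius_on (omap f : RP1 R -> RP1 R) C.
Proof.
move=> [M D H]; pose r := Num.sqrt (det M).
have r0 : 0 < r by rewrite sqrtr_gt0.
have rn0 : r != 0 by rewrite gt_eqF.
have r2 : r ^+ 2 = det M by rewrite sqr_sqrtr// ltW.
exists (ma M / r), (mb M / r), (mc M / r), (md M / r); split.
  apply: (mulIf (lt0r_neq0 D)); rewrite mul1r -{1}r2 /det; field.
  exact: rn0.
move=> t /H Ht; have n0 := mob_den D Ht; rewrite /=.
have -> : mc M / r * t + md M / r = (mc M * t + md M) / r by field.
rewrite mulf_eq0 invr_eq0 (negbTE n0) (negbTE rn0) /=; congr fin.
apply: (mulIf n0); rewrite Ht; field.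
by rewrite rn0 n0.
Qed.

Lemma monod_lift f : monod f -> exists h : monodH R, real_part h = f.
Proof.
move=> Hf; have [g [Hg fK gK]] := monod_inv Hf.
have cf := monod_continuous (monod_inc Hf) (monod_surj Hf).
have cg := monod_continuous (monod_inc Hg) (monod_surj Hg).
have Fh : `[< is_homeo (omap f : RP1 R -> RP1 R) >].
  apply/asboolP; split; first exact: omap_continuous cf cg fK gK.
  exists (omap g); split; first exact: omap_continuous cg cf gK fK.
    by case=> //= x; rewrite fK.
  by case=> //= x; rewrite gK.
have FH : Homeo Fh \in @monodH_pred R.
  apply/monodHP; split=> //; apply/piecewise_mobiusP.
  have [s Hs] := monod_pieces Hf.
  by exists s => C /Hs; exact: mob_on_mobius.
by exists (MonodH FH).
Qed.

Lemma monodH_infty (h : monodH R) : h (infty R) = infty R.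
Proof. by case: h => F FH; have /monodHP[] := FH. Qed.

Lemma real_part_injective : injective (fun h : monodH R => real_part h).
Proof.
move=> h h' E; apply/val_inj/val_inj/funext => -[t|].
  have H : real_part h t = real_part h' t by rewrite E.
  by have := real_partE (monodH_infty h) t; rewrite H -real_partE ?monodH_infty.
by transitivity (infty R); [|symmetry]; exact: monodH_infty.
Qed.

Lemma real_partM (h h' : monodH R) :
  real_part (h * h')%g = real_part h \o real_part h'.
Proof.
apply/funext => t; suff: fin (real_part (h * h')%g t) =
    fin (real_part h (real_part h' t)) by case.
by rewrite -!real_partE ?monodH_infty.
Qed.

End Transfer.

(** * Cutting the line at a fixed point *)

Section Charts.
Variable R : realType.
Implicit Types (E : cut R) (a b p t x y : R) (f g h u z : R -> R).

(** A translation on the negative half-line is followed by x |-> p - 1/(x + 1), which maps [0, +oo[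
    onto [p - 1, p[. Both branches take the value p - 1 at 0. *)
Lemma lower_chart p : exists u, [/\ inc u, forall E, pm E id u &
  forall y, y < p <-> exists x, u x = y].
Proof.
pose u x := if x < 0 then p - 1 + x else p - (x + 1)^-1.
have uN x : x < 0 -> u x = p - 1 + x by rewrite /u => ->.
have uP x : 0 <= x -> u x = p - (x + 1)^-1 by rewrite /u leNgt => /negbTE ->.
have inv_gt0 x : 0 <= x -> 0 < (x + 1)^-1 by move=> x0; rewrite invr_gt0; lra.
exists u; split.
- move=> x y xy; have [y0|y0] := ltP y 0; have [x0|x0] := ltP x 0.
  + by rewrite !uN//; lra.
  + lra.
  + rewrite uN// uP//; have : (y + 1)^-1 <= 1 by rewrite invf_le1; lra.
    lra.
  + rewrite !uP//; have : (y + 1)^-1 < (x + 1)^-1 by rewrite ltf_pV2 ?posrE; lra.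
    lra.
- move=> E; have [H|H] := ev_side E 0.
    exists (Mat p (p - 1) 1 1); first by rewrite /det /=; lra.
    apply: evS H => t t0; rewrite /mob /= uP; last exact: ltW.
    have n0 : t + 1 != 0 by rewrite gt_eqF; lra.
    by field; exact: n0.
  exists (Mat 1 (p - 1) 0 1); first by rewrite /det /=; lra.
  by apply: evS H => t t0; rewrite /mob /= uN//; ring.
- move=> y; split=> [yp|[x <-]]; last first.
    have [x0|x0] := ltP x 0; first by rewrite uN//; lra.
    by rewrite uP//; have := inv_gt0 _ x0; lra.
  have [y1|y1] := ltP y (p - 1).
    by exists (y - p + 1); rewrite uN; lra.
  exists ((p - y)^-1 - 1); rewrite uP; first by rewrite subrK invrK; lra.
  by rewrite subr_ge0 invf_ge1; lra.
Qed.

(** The lower chart at -p is conjugated by t |-> -t, which exchanges left and right cuts; [F] is the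
    mirror image of [E]. *)
Lemma upper_chart p : exists u, [/\ inc u, forall E, pm E id u &
  forall y, p < y <-> exists x, u x = y].
Proof.
have [u [ui up uim]] := lower_chart (- p).
exists (fun x => - u (- x)); split.
- by move=> x y xy; rewrite ltrN2; apply: ui; rewrite ltrN2.
- move=> E; pose F := match E with NInf => PInf | Left x => Right (- x)
    | Right x => Left (- x) | PInf => NInf end.
  have EF (P : R -> Prop) : ev F P -> ev E (fun t => P (- t)).
    rewrite /F; case: (E) => [|x|x|] /=.
    + by move=> [y Py]; exists (- y) => t ty; apply: Py; lra.
    + by move=> [y yx Py]; exists (- y) => [|t ? ?]; [lra|apply: Py; lra].
    + by move=> [y yx Py]; exists (- y) => [|t ? ?]; [lra|apply: Py; lra].
    + by move=> [y Py]; exists (- y) => t ty; apply: Py; lra.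
  have [M D H] := up F.
  exists (Mat (ma M) (- mb M) (- mc M) (md M)).
    by move: D; rewrite /det /=; lra.
  apply: evS (EF _ H) => t; rewrite /mob /=; lra.
- move=> y; split=> [py|[x <-]].
    have [x xE] : exists x, u x = - y by apply/uim; lra.
    by exists (- x); rewrite opprK xE opprK.
  by have : u (- x) < - p; [apply/uim; exists (- x)|lra].
Qed.

Lemma restrict_monod u f : inc u -> (forall E, pm E id u) ->
  (forall E, exists E', carries u E E') -> monod f ->
  (forall y, (exists x, u x = y) <-> (exists x, u x = f y)) ->
  exists2 g, monod g & forall x, u (g x) = f (u x).
Proof.
move=> ui up uc [fi fs fp] uf.
have /choice[g gE] : forall x, exists w, u w = f (u x).
  by move=> x; apply: (proj1 (uf (u x))); exists x.
have gi : inc g by move=> x y xy; rewrite -(incP ui) !gE; exact/fi/ui.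
have gs : surj g.
  move=> y; have [w wE] := fs (u y).
  have [x xE] : exists x, u x = w by apply: (proj2 (uf w)); exists y; rewrite wE.
  by exists x; apply: (inc_injective ui); rewrite gE xE.
exists g => //; split=> // E; have [E' uE] := uc E.
apply: pm_trans (up E) _; apply: pm_trans (pm_comp uE (fp E')) _.
apply: (@pm_trans _ _ _ (u \o g)); first by apply/pm_eq/evT => x /=; rewrite gE.
exact: pm_sym (pm_comp (carries_push E gi gs) (up _)).
Qed.

Variables (p : R) (u1 u2 : R -> R).
Hypotheses (u1i : inc u1) (u1p : forall E, pm E id u1).
Hypothesis u1im : forall y, y < p <-> exists x, u1 x = y.
Hypotheses (u2i : inc u2) (u2p : forall E, pm E id u2).
Hypothesis u2im : forall y, p < y <-> exists x, u2 x = y.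

Let u1c : conv u1.
Proof. by move=> a b y _ yb; apply/u1im/(lt_trans yb)/u1im; exists b. Qed.

Let u2c : conv u2.
Proof. by move=> a b y ya _; apply/u2im/(lt_trans _ ya)/u2im; exists a. Qed.

Lemma chart1_lt x : u1 x < p. Proof. by apply/u1im; exists x. Qed.
Lemma chart2_gt x : p < u2 x. Proof. by apply/u2im; exists x. Qed.

Let carries1_NInf : carries u1 NInf NInf.
Proof.
apply: carries_NInf => // y; have [t [ty tp _]] := lt_below3 y p 0.
by have /u1im[x xE] := tp; exists x; rewrite xE.
Qed.

Let carries1_PInf : carries u1 PInf (Left p).
Proof.
apply: carries_PInf_Left => //; first exact: chart1_lt.
move=> y yp; have /u1im[x xE] : (y + p) / 2 < p by lra.
by exists x; lra.
Qed.

Let carries2_NInf : carries u2 NInf (Right p).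
Proof.
apply: carries_NInf_Right => //; first exact: chart2_gt.
move=> y yp; have /u2im[x xE] : p < (y + p) / 2 by lra.
by exists x; lra.
Qed.

Let carries2_PInf : carries u2 PInf PInf.
Proof.
apply: carries_PInf => // y.
have [yp|py] := leP y p; first by exists 0; apply: le_lt_trans yp (chart2_gt _).
have /u2im[x xE] : p < y + 1 by lra.
by exists x; lra.
Qed.

Lemma carries_chart1 E : exists E', carries u1 E E'.
Proof.
by case: E => [|x|x|]; eexists;
  [exact: carries1_NInf|exact: carries_left|exact: carries_right|exact: carries1_PInf].
Qed.

Lemma carries_chart2 E : exists E', carries u2 E E'.
Proof.
by case: E => [|x|x|]; eexists;
  [exact: carries2_NInf|exact: carries_left|exact: carries_right|exact: carries2_PInf].
Qed.

(** Both charts miss p, but not its two sides: [Left p] is the image of [PInf] under [u1], and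
    [Right p] that of [NInf] under [u2]. So the germs of a glued map are all visible in the
    charts. *)
Lemma carries_charts E' : exists E, carries u1 E E' \/ carries u2 E E'.
Proof.
case: E' => [|y|y|]; [by exists NInf; left| | |by exists PInf; right].
- have [yp|yp|->] := ltgtP y p; last by exists PInf; left.
    by have /u1im[x <-] := yp; exists (Left x); left; exact: carries_left.
  by have /u2im[x <-] := yp; exists (Left x); right; exact: carries_left.
- have [yp|yp|->] := ltgtP y p; last by exists NInf; right.
    by have /u1im[x <-] := yp; exists (Right x); left; exact: carries_right.
  by have /u2im[x <-] := yp; exists (Right x); right; exact: carries_right.
Qed.

Lemma charts_cover y : [\/ exists x, y = u1 x, y = p | exists x, y = u2 x].
Proof.
have [yp|yp|->] := ltgtP y p; last by constructor 2.
  by constructor 1; have /u1im[x <-] := yp; exists x.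
by constructor 3; have /u2im[x <-] := yp; exists x.
Qed.

Definition glued f1 f2 f := [/\ f p = p, forall x, f (u1 x) = u1 (f1 x) &
  forall x, f (u2 x) = u2 (f2 x)].

Lemma exists_glued f1 f2 : exists f, glued f1 f2 f.
Proof.
suff /choice[f Hf] : forall y, exists w, [/\ y = p -> w = p,
    forall x, y = u1 x -> w = u1 (f1 x) & forall x, y = u2 x -> w = u2 (f2 x)].
  exists f; split=> [|x|x].
  - by have [+ _ _] := Hf p; exact.
  - by have [_ + _] := Hf (u1 x); exact.
  - by have [_ _ +] := Hf (u2 x); exact.
move=> y; have L x := chart1_lt x; have G x := chart2_gt x.
case: (charts_cover y) => [[x ->]|->|[x ->]].
- exists (u1 (f1 x)); split=> [E|x' /(inc_injective u1i)->//|x' E].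
    by have := L x; lra.
  by have := L x; have := G x'; lra.
- exists p; split=> // x E; last by have := G x; lra.
  by have := L x; lra.
- exists (u2 (f2 x)); split=> [E|x' E|x' /(inc_injective u2i)->//].
    by have := G x; lra.
  by have := G x; have := L x'; lra.
Qed.

Lemma glued_inj f1 f2 f g : glued f1 f2 f -> glued f1 f2 g -> f = g.
Proof.
move=> [fp f1E f2E] [gp g1E g2E]; apply/funext => y.
by case: (charts_cover y) => [[x ->]|->|[x ->]]; rewrite ?f1E ?g1E ?f2E ?g2E ?fp ?gp.
Qed.

Lemma glued_sub f1 f2 g1 g2 f : glued f1 f2 f -> glued g1 g2 f -> f1 = g1 /\ f2 = g2.
Proof.
move=> [fp f1E f2E] [gp g1E g2E]; split; apply/funext => x.
  by apply: (inc_injective u1i); rewrite -f1E g1E.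
by apply: (inc_injective u2i); rewrite -f2E g2E.
Qed.

Lemma glued_comp f1 f2 f g1 g2 g : glued f1 f2 f -> glued g1 g2 g ->
  glued (f1 \o g1) (f2 \o g2) (f \o g).
Proof.
move=> [fp f1E f2E] [gp g1E g2E]; split=> [|x|x] /=; first by rewrite gp.
  by rewrite g1E f1E.
by rewrite g2E f2E.
Qed.

Lemma glued_monod f1 f2 f : glued f1 f2 f -> monod f1 -> monod f2 -> monod f.
Proof.
move=> [fp f1E f2E] H1 H2; have [f1i f1s f1p] := H1; have [f2i f2s f2p] := H2.
have L x := chart1_lt x; have G x := chart2_gt x.
split.
- move=> x y; case: (charts_cover x) => [[x' ->]|->|[x' ->]];
    case: (charts_cover y) => [[y' ->]|->|[y' ->]]; rewrite ?f1E ?f2E ?fp.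
  + by rewrite (incP u1i) => /f1i/u1i.
  + by move=> _.
  + by move=> _; exact: lt_trans (L _) (G _).
  + by move=> H; have := L y'; lra.
  + by rewrite ltxx.
  + by move=> _.
  + by move=> H; have := lt_trans H (L _); have := G x'; lra.
  + by move=> H; have := G x'; lra.
  + by rewrite (incP u2i) => /f2i/u2i.
- move=> y; case: (charts_cover y) => [[y' ->]|->|[y' ->]].
  + by have [x <-] := f1s y'; exists (u1 x).
  + by exists p.
  + by have [x <-] := f2s y'; exists (u2 x).
- move=> E'; have [E [C|C]] := carries_charts E'; apply: (pm_comp_inv C).
  + apply: pm_trans (pm_sym (u1p E)) _; apply: pm_trans (f1p E) _.
    apply: pm_trans (pm_comp (carries_push E f1i f1s) (u1p _)) _.
    by apply/pm_eq/evT => x /=; rewrite f1E.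
  + apply: pm_trans (pm_sym (u2p E)) _; apply: pm_trans (f2p E) _.
    apply: pm_trans (pm_comp (carries_push E f2i f2s) (u2p _)) _.
    by apply/pm_eq/evT => x /=; rewrite f2E.
Qed.

Lemma monod_glued f : monod f -> f p = p ->
  exists f1 f2, [/\ monod f1, monod f2 & glued f1 f2 f].
Proof.
move=> Hf fp; have fi := monod_inc Hf.
have [|f1 H1 f1E] := restrict_monod u1i u1p carries_chart1 Hf.
  by move=> y; rewrite -!u1im -{2}fp (incP fi).
have [|f2 H2 f2E] := restrict_monod u2i u2p carries_chart2 Hf.
  by move=> y; rewrite -!u2im -{2}fp (incP fi).
by exists f1, f2; split=> //; split=> // x; rewrite ?f1E ?f2E.
Qed.

(** Gluing is multiplicative and a glued map determines its two halves, so commutation can be tested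
    on each half. *)
Lemma cz_glued z z1 z2 : monod z1 -> monod z2 -> glued z1 z2 z ->
  (forall g, cz z g -> g p = p) ->
  forall g, cz z g <-> exists g1 g2, [/\ cz z1 g1, cz z2 g2 & glued g1 g2 g].
Proof.
move=> Hz1 Hz2 gz zp g; split=> [Cg|[g1 [g2 [[H1 c1] [H2 c2] gg]]]].
  have [Hg gzE] := Cg; have [g1 [g2 [H1 H2 gg]]] := monod_glued Hg (zp g Cg).
  have := glued_comp gg gz.
  have -> : g \o z = z \o g by apply/funext => x; exact: gzE.
  move=> /(glued_sub (glued_comp gz gg))[E1 E2].
  exists g1, g2; split=> //; split=> // x.
    by have /(congr1 (@^~ x)) := E1.
  by have /(congr1 (@^~ x)) := E2.
split; first exact: glued_monod gg H1 H2.
move=> x; rewrite -[LHS]/((g \o z) x) -[RHS]/((z \o g) x).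
congr (_ x); apply: (glued_inj (glued_comp gg gz)).
have := glued_comp gz gg.
have -> : z1 \o g1 = g1 \o z1 by apply/funext => w; rewrite /= c1.
by have -> : z2 \o g2 = g2 \o z2 by apply/funext => w; rewrite /= c2.
Qed.

(* x is a boundary point of the fixed-point set of z *)
Definition bd z x := z x = x /\
  ~ (ev (Left x) (fun t => z t = t) /\ ev (Right x) (fun t => z t = t)).

(** This form covers both uses: [u] a chart onto a half-line, and [u] an element commuting with [z],
    with f = z. *)
Lemma bd_image u f z x : inc u -> conv u -> (forall x, f (u x) = u (z x)) ->
  bd z x -> bd f (u x).
Proof.
move=> ui uc fu [zx nfix]; split; first by rewrite fu zx.
have H t : f (u t) = u t -> z t = t by rewrite fu => /(inc_injective ui).
move=> [/(carries_left x ui uc) HL /(carries_right x ui uc) HR]; apply: nfix.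
by split; [apply: evS HL|apply: evS HR].
Qed.

Lemma bd_glued1 z1 z2 z x : glued z1 z2 z -> bd z1 x -> bd z (u1 x).
Proof. by move=> [_ E _]; exact: bd_image. Qed.

Lemma bd_glued2 z1 z2 z x : glued z1 z2 z -> bd z2 x -> bd z (u2 x).
Proof. by move=> [_ _ E]; exact: bd_image. Qed.

End Charts.

(** * Boundary points of the fixed-point set *)

Section Boundary.
Variable R : realType.
Implicit Types (E : cut R) (a b p t x y : R) (f g h u z : R -> R).

Lemma bd_cz z g x : cz z g -> bd z x -> bd z (g x).
Proof.
move=> [[gi gs _] gz]; apply: bd_image => //; exact: surj_conv.
Qed.

(** Fixed points of a Mobius germ are roots of a polynomial of degree at most 2. If they accumulate
    at [E], three distinct ones make the polynomial zero. *)
Lemma ev_fixed_dec z E : pm E id z ->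
  ev E (fun t => z t = t) \/ ev E (fun t => z t <> t).
Proof.
move=> [M D HM]; have [|nev] := pselect (ev E (fun t => z t <> t)); first by right.
left; have freq P : ev E P -> exists t, P t /\ z t = t.
  move=> EP; apply: contrapT => /forallNP nP; apply: nev.
  by apply: evS EP => t Pt zt; exact: (nP t).
have [x1 [H1 z1]] := freq _ HM.
have [x2 [[H2 x21] z2]] := freq _ (evI HM (ev_neq E x1)).
have [x3 [[[H3 x31] x32] z3]] := freq _ (evI (evI HM (ev_neq E x1)) (ev_neq E x2)).
have q t : mob M t t <-> mc M * t ^+ 2 + (md M - ma M) * t + - mb M = 0.
  by rewrite /mob; split=> H; [rewrite expr2|move: H; rewrite expr2]; lra.
apply: evS HM => t Ht; apply: (mob_fun D Ht).
apply/q; apply: (@quadratic_eq0 _ _ _ _ x1 x2 x3) => //; apply/q.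
- by rewrite -{2}z1.
- by rewrite -{2}z2.
- by rewrite -{2}z3.
Qed.

(** By [ev_fixed_dec], the points close to the cut are either all interior to the fixed-point set or
    all outside it. *)
Lemma ev_not_bd z E : pm E id z -> ev E (fun t => ~ bd z t).
Proof.
move=> /ev_fixed_dec[/ev_open|]; apply: evS => t; last by move=> H [].
move=> [a [b [at_ tb H]]] [_]; apply; split; [exists a|exists b] => // w.
  by move=> aw wt; apply: H => //; lra.
by move=> tw wb; apply: H => //; lra.
Qed.

Lemma finite_bd z : monod z -> exists l : seq R, forall x, bd z x -> x \in l.
Proof.
move=> [_ _ zp].
have Q y : exists l : seq R, forall x, x <= y -> bd z x -> x \in l.
  elim/real_ind: y.
  - have [y Hy] := ev_not_bd (zp NInf); exists (y - 1), [::] => x xy Bx.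
    by case: (Hy x) => //; lra.
  - by move=> x y yx [l Hl]; exists l => t ty; apply: Hl; lra.
  - move=> x IH; have [y yx Hy] := ev_not_bd (zp (Left x)).
    have [l Hl] := IH y yx; exists (x :: l) => t tx Bt; rewrite inE.
    have [//|tx'] := eqVneq t x; apply: Hl => //; rewrite leNgt; apply/negP => yt.
    by apply: (Hy t) => //; rewrite lt_neqAle tx'.
  - move=> x [l Hl]; have [y xy Hy] := ev_not_bd (zp (Right x)).
    exists ((x + y) / 2); first by lra.
    exists l => t ty Bt; apply: Hl => //; rewrite leNgt; apply/negP => xt.
    by apply: (Hy t) => //; lra.
have [y Hy] := ev_not_bd (zp PInf); have [l Hl] := Q y.
exists l => t Bt; apply: Hl => //; rewrite leNgt; apply/negP => yt.
exact: (Hy t).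
Qed.

(** Without boundary points the closed fixed-point set is also open. Continuous induction runs on
    the radius of a fixed interval centred at x0. *)
Lemma all_fixed z x0 : monod z -> (forall x, ~ bd z x) -> z x0 = x0 -> z = id.
Proof.
move=> [zi zs _] nbd zx0.
have nfix x : z x = x ->
    ev (Left x) (fun t => z t = t) /\ ev (Right x) (fun t => z t = t).
  by move=> zx; apply: contrapT => H; exact: (nbd x).
have ck : continuous (fun t => z t - t).
  by move=> x; apply: cvgB; [exact: monod_continuous|exact: cvg_id].
have Q r : forall t, x0 - r <= t -> t <= x0 + r -> z t = t.
  elim/real_ind: r.
  - by exists 0 => t H1 H2; have -> : t = x0 by lra.
  - by move=> r r' r'r IH t H1 H2; apply: IH; lra.
  - move=> r IH t H1 H2.
    have [r0|r0] := ltP 0 r; last by have -> : t = x0 by lra.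
    apply/eqP; rewrite -subr_eq0; apply/eqP.
    apply: (@continuous_eq0_closure _ (fun t => z t - t) (x0 - r) (x0 + r)) => //.
    + by lra.
    + move=> w w1 w2; rewrite (IH `|w - x0|) ?subrr//.
      * by rewrite ltr_norml; apply/andP; split; lra.
      * by have := ler_norm (x0 - w); rewrite distrC; lra.
      * by have := ler_norm (w - x0); lra.
    + by apply/andP; split.
  - move=> r IH; have [r0|r0] := ltP r 0.
      by exists 0 => // t H1 H2; have -> : t = x0 by lra.
    have [_ [y1 ry1 F1]] : _ /\ ev (Right (x0 + r)) _ := nfix _ (IH (x0 + r) ltac:(lra) ltac:(lra)).
    have [[y2 ry2 F2] _] : ev (Left (x0 - r)) _ /\ _ := nfix _ (IH (x0 - r) ltac:(lra) ltac:(lra)).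
    have [w [w1 w2 w3]] : exists w, [/\ r < w, x0 + w < y1 & y2 < x0 - w].
      pose d := Order.min (y1 - (x0 + r)) (x0 - r - y2) / 2.
      have d0 : 0 < d by rewrite divr_gt0// lt_min !subr_gt0 ry1.
      have [d1 d2] : d * 2 <= y1 - (x0 + r) /\ d * 2 <= x0 - r - y2.
        by rewrite divfK ?pnatr_eq0// !ge_min !lexx orbT.
      by exists (r + d); split; lra.
    exists w => // t H1 H2; have [tr|tr] := ltP (x0 + r) t; first by apply: F1; lra.
    have [tr'|tr'] := ltP t (x0 - r); first by apply: F2; lra.
    exact: IH.
apply/funext => t; apply: (Q `|t - x0|).
  by have := ler_norm (x0 - t); rewrite distrC; lra.
by have := ler_norm (t - x0); lra.
Qed.

Lemma no_bd z : monod z -> (forall x, ~ bd z x) ->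
  [\/ z = id, forall x, x < z x | forall x, z x < x].
Proof.
move=> Hz nbd; have [[x0 zx0]|nfix] := pselect (exists x, z x = x).
  by constructor 1; exact: all_fixed zx0.
have [zi zs _] := Hz.
have ck : continuous (fun t => z t - t).
  by move=> x; apply: cvgB; [exact: monod_continuous|exact: cvg_id].
have [|/existsNP[x /negP zx]] := pselect (forall x, x < z x); first by constructor 2.
have [|/existsNP[y /negP zy]] := pselect (forall x, z x < x); first by constructor 3.
exfalso; move: zx zy; rewrite -!leNgt => zx zy; apply: nfix.
have ckw (a b : R) : {within `[a, b], continuous (fun t => z t - t)}.
  exact: continuous_subspaceT.
have [xy|/ltW yx] := leP x y.
  have [|w _ /eqP] := IVT (v := 0) xy (@ckw x y).
    by rewrite ge_min le_max; apply/andP; split; apply/orP; [left|right]; lra.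
  by rewrite subr_eq0 => /eqP zw; exists w.
have [|w _ /eqP] := IVT (v := 0) yx (@ckw y x).
  by rewrite ge_min le_max; apply/andP; split; apply/orP; [right|left]; lra.
by rewrite subr_eq0 => /eqP zw; exists w.
Qed.

Lemma seq_min (P : R -> Prop) (l : seq R) : (exists x, P x) ->
  (forall x, P x -> x \in l) -> exists2 p, P p & forall x, P x -> p <= x.
Proof.
elim: l P => [|a l IH] P [x0 Px0] Pl; first by have := Pl x0 Px0.
have [[x [Px xa]]|nex] := pselect (exists x, P x /\ x != a); last first.
  have Pa x : P x -> x = a.
    by move=> Px; apply: contrapT => /eqP xa; apply: nex; exists x.
  by exists x0 => // x Px; rewrite (Pa x Px) (Pa x0 Px0).
have [||m [Pm ma_] mmin] := IH (fun x => P x /\ x != a).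
- by exists x.
- by move=> w [Pw wa]; have := Pl w Pw; rewrite inE (negbTE wa).
have [Pa|nPa] := pselect (P a); last first.
  exists m => // w Pw; apply: mmin; split=> //.
  by apply/eqP => wa; apply: nPa; rewrite -wa.
have [am|ma'] := leP a m.
  exists a => // w Pw; have [->//|wa] := eqVneq w a.
  exact: le_trans am (mmin w (conj Pw wa)).
exists m => // w Pw; have [->|wa] := eqVneq w a; first exact: ltW.
exact: mmin.
Qed.

End Boundary.

(** * Presentations of the centralizers *)

Section FfunCat.
Variables (n1 n2 : nat) (T : Type).

Definition ffun_lsub (a : {ffun 'I_(n1 + n2) -> T}) := [ffun i : 'I_n1 => a (lshift n2 i)].
Definition ffun_rsub (a : {ffun 'I_(n1 + n2) -> T}) := [ffun i : 'I_n2 => a (rshift n1 i)].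
Definition ffun_cat (a1 : {ffun 'I_n1 -> T}) (a2 : {ffun 'I_n2 -> T}) :=
  [ffun i => match fintype.split i with inl j => a1 j | inr j => a2 j end].

Lemma ffun_lsub_cat a1 a2 : ffun_lsub (ffun_cat a1 a2) = a1.
Proof.
apply/ffunP => i; rewrite !ffunE.
by have /= -> := @unsplitK n1 n2 (inl i).
Qed.

Lemma ffun_rsub_cat a1 a2 : ffun_rsub (ffun_cat a1 a2) = a2.
Proof.
apply/ffunP => i; rewrite !ffunE.
by have /= -> := @unsplitK n1 n2 (inr i).
Qed.

Lemma ffun_sub_inj a b :
  ffun_lsub a = ffun_lsub b -> ffun_rsub a = ffun_rsub b -> a = b.
Proof.
move=> /ffunP L /ffunP Q; apply/ffunP => i; case: (split_ordP i) => j ->.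
  by have := L j; rewrite !ffunE.
by have := Q j; rewrite !ffunE.
Qed.

End FfunCat.

Lemma ffun_lsubM n1 n2 (G : groupType) (a b : {ffun 'I_(n1 + n2) -> G}) :
  ffun_lsub (a * b)%g = (ffun_lsub a * ffun_lsub b)%g.
Proof. by apply/ffunP => i; rewrite !ffunE. Qed.

Lemma ffun_rsubM n1 n2 (G : groupType) (a b : {ffun 'I_(n1 + n2) -> G}) :
  ffun_rsub (a * b)%g = (ffun_rsub a * ffun_rsub b)%g.
Proof. by apply/ffunP => i; rewrite !ffunE. Qed.

Section Good.
Variable R : realType.
Implicit Types (P : (R -> R) -> Prop) (z f g : R -> R).

Definition model n m k : groupType :=
  ({ffun 'I_n -> Algebra.to_multiplicative int} *
   {ffun 'I_m -> Algebra.to_multiplicative R} *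
   {ffun 'I_k -> monodH R})%type.

(** Centralizers are treated as sets of real maps parametrized by a group; no group structure has to
    be built on the centralizers of the two halves. *)
Definition presents (G : groupType) (Phi : G -> R -> R) P :=
  [/\ injective Phi, {morph Phi : x y / (x * y)%g >-> x \o y} &
      forall f, P f <-> exists x, Phi x = f].

Definition good P := exists n m k (Phi : model n m k -> R -> R), presents Phi P.

Lemma good_ext P Q : (forall f, P f <-> Q f) -> good P -> good Q.
Proof.
move=> PQ [n [m [k [Phi [Pinj PM Pim]]]]]; exists n, m, k, Phi; split=> // f.
by rewrite -PQ.
Qed.

Lemma good_int (phi : int -> R -> R) P : injective phi ->
  (forall a b, phi (a + b) = phi a \o phi b) ->
  (forall f, P f <-> exists a, phi a = f) -> good P.
Proof.
move=> pinj pM pim; exists 1%N, 0%N, 0%N, (fun x : model 1 0 0 => phi (x.1.1 ord0)); split.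
- move=> [[a1 b1] c1] [[a2 b2] c2] /= /pinj E.
  by congr (_, _, _); apply/ffunP => i; rewrite ?ord1 ?E; case: i.
- by move=> [[a1 b1] c1] [[a2 b2] c2] /=; rewrite ffunE; exact: pM.
- move=> f; rewrite pim; split=> [[a <-]|[x <-]]; last by exists (x.1.1 ord0).
  by exists ([ffun => a], 1%g, 1%g); rewrite /= ffunE.
Qed.

Lemma good_real (phi : R -> R -> R) P : injective phi ->
  (forall a b, phi (a + b) = phi a \o phi b) ->
  (forall f, P f <-> exists a, phi a = f) -> good P.
Proof.
move=> pinj pM pim; exists 0%N, 1%N, 0%N, (fun x : model 0 1 0 => phi (x.1.2 ord0)); split.
- move=> [[a1 b1] c1] [[a2 b2] c2] /= /pinj E.
  by congr (_, _, _); apply/ffunP => i; rewrite ?ord1 ?E; case: i.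
- by move=> [[a1 b1] c1] [[a2 b2] c2] /=; rewrite ffunE; exact: pM.
- move=> f; rewrite pim; split=> [[a <-]|[x <-]]; last by exists (x.1.2 ord0).
  by exists (1%g, [ffun => a], 1%g); rewrite /= ffunE.
Qed.

Lemma good_monod : good (@monod R).
Proof.
exists 0%N, 0%N, 1%N, (fun x : model 0 0 1 => real_part (x.2 ord0)); split.
- move=> [[a1 b1] c1] [[a2 b2] c2] /= /(@real_part_injective R) E.
  by congr (_, _, _); apply/ffunP => i; rewrite ?ord1 ?E; case: i.
- by move=> [[a1 b1] c1] [[a2 b2] c2] /=; rewrite ffunE; exact: real_partM.
- move=> f; split=> [/monod_lift[h <-]|[x <-]]; last exact: monod_real_part.
  by exists (1%g, 1%g, [ffun => h]); rewrite /= ffunE.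
Qed.

(** An internal direct product: [gl] multiplies the two factors, and the exponents of the two models
    add. *)
Lemma good_prod P1 P2 P (gl : (R -> R) -> (R -> R) -> (R -> R)) :
  good P1 -> good P2 ->
  (forall f, P f <-> exists f1 f2, [/\ P1 f1, P2 f2 & gl f1 f2 = f]) ->
  (forall f1 f2 g1 g2, gl f1 f2 = gl g1 g2 -> f1 = g1 /\ f2 = g2) ->
  (forall f1 f2 g1 g2, gl (f1 \o g1) (f2 \o g2) = gl f1 f2 \o gl g1 g2) ->
  good P.
Proof.
move=> [n1 [m1 [k1 [Phi1 [inj1 M1 im1]]]]] [n2 [m2 [k2 [Phi2 [inj2 M2 im2]]]]].
move=> Pgl glinj glM; exists (n1 + n2)%N, (m1 + m2)%N, (k1 + k2)%N.
pose lsub (x : model (n1 + n2) (m1 + m2) (k1 + k2)) : model n1 m1 k1 :=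
  (ffun_lsub x.1.1, ffun_lsub x.1.2, ffun_lsub x.2).
pose rsub (x : model (n1 + n2) (m1 + m2) (k1 + k2)) : model n2 m2 k2 :=
  (ffun_rsub x.1.1, ffun_rsub x.1.2, ffun_rsub x.2).
exists (fun x => gl (Phi1 (lsub x)) (Phi2 (rsub x))); split.
- move=> [[a1 b1] c1] [[a2 b2] c2] /glinj[/inj1 + /inj2 +].
  rewrite /lsub /rsub /= => -[La Lb Lc] [Ra Rb Rc].
  by congr (_, _, _); exact: ffun_sub_inj.
- move=> x y.
  have -> : lsub (x * y)%g = (lsub x * lsub y)%g.
    by rewrite /lsub /= !ffun_lsubM.
  have -> : rsub (x * y)%g = (rsub x * rsub y)%g.
    by rewrite /rsub /= !ffun_rsubM.
  by rewrite M1 M2 glM.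
- move=> f; rewrite Pgl; split=> [[f1 [f2 [/im1[x <-] /im2[y <-] <-]]]|[x <-]].
    exists (ffun_cat x.1.1 y.1.1, ffun_cat x.1.2 y.1.2, ffun_cat x.2 y.2).
    rewrite /lsub /rsub /= !ffun_lsub_cat !ffun_rsub_cat.
    by case: x => -[? ?] ?; case: y => -[? ?] ?.
  exists (Phi1 (lsub x)), (Phi2 (rsub x)); split=> //; first by apply/im1; eexists.
  by apply/im2; eexists.
Qed.

Lemma good_cz_gt z : monod z -> (forall x, x < z x) -> good (cz z).
Proof.
move=> Hz /(centralizer_fixpoint_free Hz)[phi [phiD phi_inj [im|[s0 s0n0 im]]]].
  by apply: (@good_real phi) => // f; rewrite im; split=> [[s ->]|[s <-]]; exists s.
apply: (@good_int (fun k => phi (s0 * k%:~R))).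
- by move=> k k' /phi_inj/(mulfI s0n0)/intr_inj.
- by move=> k k'; rewrite intrD mulrDr phiD.
- by move=> f; rewrite im; split=> [[k ->]|[k <-]]; exists k.
Qed.

Lemma good_cz_no_bd z : monod z -> (forall x, ~ bd z x) -> good (cz z).
Proof.
move=> Hz /(no_bd Hz)[zE|zgt|zlt]; last 2 first.
- exact: good_cz_gt.
(* If [z] moves points down, its inverse moves them up and has the same centralizer. *)
- have [zi [Hzi zK ziK]] := monod_inv Hz.
  apply: good_ext (good_cz_gt Hzi _) => [g|x]; last by rewrite -{1}[x]ziK.
  split=> -[Hg gz]; split=> // x.
    by apply: (can_inj ziK); rewrite zK -gz zK.
  by apply: (can_inj zK); rewrite ziK -gz ziK.
by apply: good_ext good_monod => f; rewrite zE; split=> [|[]].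
Qed.

(** Cutting at the least boundary point p leaves no boundary point on the lower half. Only the upper
    half needs the induction hypothesis, and it has lost p. *)
Lemma good_cz_bounded_bd N z (l : seq R) : monod z -> (size l <= N)%N ->
  (forall x, bd z x -> x \in l) -> good (cz z).
Proof.
elim: N z l => [|N IH] z l Hz lN zl.
  apply: good_cz_no_bd => // x /zl.
  by move: lN; rewrite leqn0 size_eq0 => /eqP ->.
have [[x0 Bx0]|nbd] := pselect (exists x, bd z x); last first.
  by apply: good_cz_no_bd => // x Bx; apply: nbd; exists x.
have [p Bp pmin] := seq_min (ex_intro _ x0 Bx0) zl.
(* Both g p and the preimage of p under g are boundary points, hence at least p; monotonicity of g
   gives equality. *)
have fixp g : cz z g -> g p = p.
  move=> Cg; have [Hg gz] := Cg; have [gi [Hgi gK giK]] := monod_inv Hg.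
  have Cgi : cz z gi.
    by split=> // x; apply: (can_inj gK); rewrite giK gz giK.
  apply/eqP; rewrite eq_le [p <= _]pmin ?andbT; last exact: bd_cz Bp.
  by have := pmin _ (bd_cz Cgi Bp); rewrite -(le_mono (monod_inc Hg)) giK.
have [u1 [u1i u1p u1im]] := lower_chart p.
have [u2 [u2i u2p u2im]] := upper_chart p.
have zp : z p = p by have [] := Bp.
have [z1 [z2 [Hz1 Hz2 gz]]] := monod_glued u1i u1p u1im u2i u2p u2im Hz zp.
have /choice[gl glE] : forall f12 : (R -> R) * (R -> R), exists f,
    glued p u1 u2 f12.1 f12.2 f.
  by move=> f12; exact: (exists_glued u1i u1im u2i u2im).
apply: (@good_prod (cz z1) (cz z2) _ (fun f1 f2 => gl (f1, f2))).
- apply: good_cz_no_bd => // x /(bd_glued1 u1i u1im gz)/pmin.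
  by rewrite leNgt (chart1_lt u1im).
(* [v2] inverts the upper chart, with default value 0 outside its image. It pulls the remaining
   boundary points back to the line. *)
- have /choice[v2 v2E] : forall y, exists x, p < y -> u2 x = y.
    move=> y; have [|yp] := boolP (p < y); last by exists 0.
    by move/u2im => [x xE]; exists x.
  apply: (IH z2 [seq v2 y | y <- rem p l]) => //.
    by rewrite size_map size_rem ?zl//; case: (size l) lN.
  move=> x /(bd_glued2 u2i u2im gz)/zl u2l.
  have pu2 : p < u2 x by apply/u2im; exists x.
  apply/mapP; exists (u2 x).
    by rewrite rem_mem// gt_eqF.
  by apply: (inc_injective u2i); rewrite v2E.
- move=> f; rewrite (cz_glued u1i u1p u1im u2i u2p u2im Hz1 Hz2 gz fixp).
  split=> -[f1 [f2 [C1 C2 H]]]; exists f1, f2; split=> //.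
    exact: (glued_inj u1im u2im (glE (f1, f2)) H).
  by rewrite -H; exact: (glE (f1, f2)).
- move=> f1 f2 g1 g2 E; have := glE (f1, f2); rewrite E.
  by move=> H; exact: (glued_sub u1i u2i H (glE (g1, g2))).
- move=> f1 f2 g1 g2; apply: (glued_inj u1im u2im (glE (_, _))).
  exact: (glued_comp (glE (f1, f2)) (glE (g1, g2))).
Qed.

Lemma good_cz z : monod z -> good (cz z).
Proof.
by move=> Hz; have [l Hl] := finite_bd Hz; exact: (good_cz_bounded_bd Hz (leqnn _) Hl).
Qed.

End Good.

Theorem theorem1 (R : realType) (z : monodH R) :
  exists k m n : nat,
    group_isomorphic (centralizer z)
      ({ffun 'I_n -> Algebra.to_multiplicative int} *
       {ffun 'I_m -> Algebra.to_multiplicative R} *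
       {ffun 'I_k -> monodH R})%type.
Proof.
have [n [m [k [Phi [Phi_inj PhiM Phi_im]]]]] := good_cz (monod_real_part z).
exists k, m, n.
pose rp (g : centralizer z) := real_part (val g).
have rp_inj : injective rp.
  by move=> g h /(@real_part_injective R)/val_inj.
have rpM g h : rp (g * h)%g = rp g \o rp h by exact: real_partM.
have rp_cz g : cz (real_part z) (rp g).
  split; first exact: monod_real_part.
  move=> x; have /eqP gz := valP g.
  by have := congr1 (fun h : monodH R => real_part h x) gz; rewrite !real_partM.
(* [Phi] and [rp] are injective, multiplicative and have the same image, so matching their values
   gives the isomorphism. *)
have /choice[phi phiE] : forall g, exists x, Phi x = rp g.
  by move=> g; apply/Phi_im.
have /choice[psi psiE] : forall x, exists g, rp g = Phi x.
  move=> x; have [/monod_lift[h hE] hz] : cz (real_part z) (Phi x).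
    by apply/Phi_im; exists x.
  have hzE : (h * z = z * h)%g.
    apply: real_part_injective; rewrite !real_partM.
    by apply/funext => t; rewrite /= hE hz.
  have hc : h \in centralizes z by rewrite inE hzE.
  by exists (Centralizer hc).
exists phi.
  exists psi => x; first by apply: rp_inj; rewrite psiE phiE.
  by apply: Phi_inj; rewrite phiE psiE.
by move=> g h; apply: Phi_inj; rewrite PhiM !phiE rpM.
Qed.
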